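(* Let $\psi\in\Psi$. Exactly one of the following two mutually exclusive alternatives holds. (1) There exist $q\in[\frac12,1)$ and $C>0$ such that $$\|A_n\|_{\mathcal{L}(\Lambda(\psi))}\leq C\cdot n^q\quad\text{for all } n\geq1.$$ (2) Either for every $k\in\mathbb{N}$, $$\limsup_{u\rightarrow0}\frac{\psi(ku)}{\psi(u)}=k,$$ or for every $l\in\mathbb{N}$, $$\limsup_{u\rightarrow0}\frac{\psi(u^l)}{\psi(u)}=1.$$
   Context: $\Psi$ is the set of all increasing continuous concave functions $\psi$ on $[0,1]$ with $\psi(0)=0$. For a measurable function $x$ on a probability space $(\Omega,\mathcal P)$, $x^*(t)=\inf\{s\ge 0:\mathcal P(|x|>s)\le t\}$ denotes its non-increasing rearrangement. For $\psi\in\Psi$, the Lorentz space $\Lambda(\psi)$ consists of measurable functions $x$ (on $[0,1]$ with Lebesgue measure) with finite norm $\|x\|_{\Lambda(\psi)}=\int_0^1x^*(t)\,d\psi(t)$. For a probability space $(\Omega,\mathcal P)$, $\Lambda(\psi)(\Omega)=\{f\in L_1(\Omega,\mathcal P): f^*\in \Lambda(\psi)\}$ with norm $\|f\|=\|f^*\|_{\Lambda(\psi)}$. Operators $A_n$: let $r$ be a centered Bernoulli random variable on $[0,1]$ (values $\pm1$, each with probability $\frac12$). For $n\ge1$ and $f\in\Lambda(\psi)$, $A_nf=(f\otimes r)_1+\cdots+(f\otimes r)_n$ is the function on $[0,1]^{2n}$ (with Lebesgue measure) given by $(A_nf)(s_1,t_1,\dots,s_n,t_n)=\sum_{k=1}^n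 f(s_k)r(t_k)$. $\|A_n\|_{\mathcal L(\Lambda(\psi))}$ denotes the norm of $A_n$ as an operator from $\Lambda(\psi)([0,1])$ to $\Lambda(\psi)([0,1]^{2n})$. *)

(* Defs.v *)
From HB Require Import structures.
From mathcomp Require Import all_boot all_order all_algebra.
From mathcomp Require Import all_classical all_reals all_analysis.

Set Implicit Arguments.
Unset Strict Implicit.
Unset Printing Implicit Defensive.
Import Order.TTheory GRing.Theory Num.Theory.
Import numFieldNormedType.Exports.
Local Open Scope classical_set_scope.
Local Open Scope ring_scope.

(* The class Psi.  Only the restriction of [psi_fun] to [0, 1] is meaningful.
   "Increasing" is read as nondecreasing and not identically zero; this includes
   the strictly increasing functions. *)
Record Psi (R : realType) := MkPsi {
  psi_fun :> R -> R ;
  psi_nd : {in `[0, 1] &, {homo psi_fun : x y / x <= y}} ;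
  psi_continuous : {within `[0, 1], continuous psi_fun} ;
  psi_concave : {in `[0, 1] & &, forall x y t : R,
    t * psi_fun x + (1 - t) * psi_fun y <= psi_fun (t * x + (1 - t) * y)} ;
  psi0 : psi_fun 0 = 0 ;
  psi1_gt0 : 0 < psi_fun 1 }.

Section stieltjes.
Context {R : realType}.

Definition clamp01 (x : R) : R := Num.max 0 (Num.min x 1).

(* [psi] prolonged by constants outside [0, 1], so that its Lebesgue-Stieltjes
   measure on the line lives on [0, 1]. *)
Definition psi_ext (psi : Psi R) (x : R) : R := psi (clamp01 x).

Lemma clamp01_itv (x : R) : clamp01 x \in `[0, 1].
Proof. by rewrite in_itv/= /clamp01 le_max lexx/= ge_max ler01 ge_min lexx orbT. Qed.

Lemma clamp01_continuous : continuous clamp01.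
Proof.
move=> x; apply: (@continuous_max R R (cst 0) (fun y => Num.min y 1)).
  exact: cvg_cst.
by apply: (@continuous_min R R idfun (cst 1)); [exact: cvg_id|exact: cvg_cst].
Qed.

Lemma psi_ext_nd (psi : Psi R) : nondecreasing (psi_ext psi).
Proof.
move=> x y xy; apply: psi_nd; rewrite ?clamp01_itv// /clamp01.
have mxy : Num.min x 1 <= Num.min y 1 by rewrite le_min !ge_min xy lexx !orbT.
by rewrite ge_max !le_max lexx mxy orbT.
Qed.

Lemma psi_ext_continuous (psi : Psi R) : continuous (psi_ext psi).
Proof.
move=> x; have /subspace_continuousP psic := @psi_continuous R psi.
apply: cvg_comp (psic _ (clamp01_itv x)) => U.
rewrite /within/= => /(@clamp01_continuous x) /= cU.
by apply: (@filterS _ (nbhs x) _ _ _ _ cU) => y /(_ (clamp01_itv y)).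
Qed.

Lemma psi_ext_rc (psi : Psi R) : right_continuous (psi_ext psi).
Proof. exact/right_continuousW/psi_ext_continuous. Qed.

HB.instance Definition _ (psi : Psi R) :=
  isCumulative.Build R _ R (psi_ext psi) (@psi_ext_nd psi) (@psi_ext_rc psi).

Definition dpsi (psi : Psi R) : {measure set (measurableTypeR R) -> \bar R} :=
  lebesgue_stieltjes_measure (psi_ext psi).

End stieltjes.

Section unit_interval.
Context {R : realType}.

(* The probability space [0, 1] with Lebesgue measure, carried by the line:
   functions on [0, 1] are functions on R modulo null sets. *)
Definition leb01 : set (measurableTypeR R) -> \bar R :=
  mrestr (@lebesgue_measure R) (measurable_itv `[0, 1]).

HB.instance Definition _ := Measure.on leb01.

Lemma leb01_setT : leb01 [set: _] = 1%E.
Proof.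
rewrite /leb01 /mrestr setTI.
by rewrite lebesgue_measure_itv/= lte_fin ltr01 oppr0 adde0.
Qed.

HB.instance Definition _ := Measure_isProbability.Build _ _ R leb01 leb01_setT.

End unit_interval.

Section power.
Context d (T : measurableType d) (R : realType).

Definition cons_pair n (x : T * n.-tuple T) : n.+1.-tuple T :=
  [the n.+1.-tuple T of x.1 :: x.2].

Lemma measurable_cons_pair n : measurable_fun [set: T * n.-tuple T] (@cons_pair n).
Proof. by apply: measurable_cons; [exact: measurable_fst|exact: measurable_snd]. Qed.

HB.instance Definition _ n :=
  isMeasurableFun.Build _ _ _ _ (@cons_pair n) (@measurable_cons_pair n).

Fixpoint power_prob (P : probability T R) (n : nat) : probability (n.-tuple T) R :=
  match n with
  | 0 => \d_([tuple])
  | m.+1 => distribution (P \x power_prob P m)%E (@cons_pair m)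
  end.

End power.

Section lorentz.
Context {R : realType}.
Local Open Scope ereal_scope.

(* The non-increasing rearrangement of [x]; its value at t = 0 is the essential
   supremum of |x|, possibly +oo, hence the codomain. *)
Definition rearrangement d (T : measurableType d) (P : set T -> \bar R)
    (x : T -> \bar R) (t : R) : \bar R :=
  ereal_inf [set s%:E | s in [set s : R |
    (0 <= s)%R /\ P [set w | s%:E < `|x w|] <= t%:E]].

Definition lorentz_norm (psi : Psi R) (x : R -> \bar R) : \bar R :=
  \int[dpsi psi]_(t in `[0%R, 1%R]) rearrangement leb01 x t.

Definition lorentz (psi : Psi R) : set (R -> R) :=
  [set x | measurable_fun setT x /\ lorentz_norm psi (EFin \o x) < +oo].

Definition lorentz_norm_on (psi : Psi R) d (T : measurableType d)
    (P : set T -> \bar R) (f : T -> R) : \bar R :=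
  lorentz_norm psi (rearrangement P (EFin \o f)).

(* A point (s_1, t_1, ..., s_n, t_n) of [0, 1]^2n is an n-tuple of pairs. *)
Definition opA (r : R -> R) (n : nat) (f : R -> R)
    (w : n.-tuple (measurableTypeR R * measurableTypeR R)%type) : R :=
  (\sum_(k < n) f (tnth w k).1 * r (tnth w k).2)%R.

Definition leb01_pow (n : nat) :
    probability (n.-tuple (measurableTypeR R * measurableTypeR R)%type) R :=
  power_prob (leb01 \x leb01) n.

Definition opnorm (psi : Psi R) (r : R -> R) (n : nat) : \bar R :=
  ereal_sup [set lorentz_norm_on psi (leb01_pow n) (opA r f) |
    f in [set f | lorentz psi f /\ lorentz_norm psi (EFin \o f) <= 1]].

Definition centered_bernoulli (r : R -> R) : Prop :=
  [/\ measurable_fun setT r,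
      leb01 [set t | r t = 1%R] = (2^-1)%:E &
      leb01 [set t | r t = (-1)%R] = (2^-1)%:E].

End lorentz.

Definition limsup0 {R : realType} (g : R -> R) : \bar R :=
  limf_esup (EFin \o g) 0^'+.

(* Main.v *)
Require Import Defs.
From mathcomp Require Import all_boot all_order all_algebra.
From mathcomp Require Import all_classical all_reals all_analysis.
From mathcomp Require Import measurable_realfun ring lra.
Import Order.TTheory GRing.Theory Num.Theory.
Import numFieldNormedType.Exports.
Local Open Scope classical_set_scope.
Local Open Scope ring_scope.
Set Implicit Arguments.
Unset Strict Implicit.
Unset Printing Implicit Defensive.

(** By the layer-cake formula the Lorentz norm of x over a probability space is
the integral over s >= 0 of psi (P (|x| > s)) ([lorentz_norm_onE]), so that only
distribution functions matter.

Reduction to indicators.  Concavity makes the Lorentz norm of g the supremum of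
the integrals of |g| against the measures nu with nu A <= psi (P A) for every
event A ([tail_integral_le_dual], [integral_le_tail_integral]).  For a fixed nu
the integral of |A_n f| is subadditive in f, and f is the integral over s of the
signed indicators sgn f * 1_(|f| > s).  Hence a bound K psi(u) on the norm of
A_n e, valid for all e with values in {-1, 0, 1} and support of measure u, is a
bound K on the norm of A_n ([tail_integral_opA_le]).  For such an e, A_n e is a
sum S of n independent symmetric variables with values in {-1, 0, 1}, nonzero
with probability u, and the question becomes how large the integral of
psi (P (|S| > s)) over 0 <= s < n is, compared with psi u.

If the second alternative fails, then for some k and l the ratio psi(k u) / psi(u)
stays below a constant less than k, and psi(u^l) / psi(u) below a constant less
than 1, for all small u ([limsup_dilation_lt], [limsup_power_lt]).  Iterating
these two facts gives, for some a in [1/2, 1) and g > 0,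
  psi(t u) <= C t^a psi(u)   and   psi(u^m) <= D m^(-g) psi(u)
([psi_growth], [psi_decay]).  Put d = (1 - a) / 2 and cut the integral at
T = n^d max(1, sqrt(n u)).  Before T the integrand is at most psi (min(1, n u)),
and the growth estimate bounds the contribution by n^(a + d) psi(u).  After T
the exponential moments of S make P (|S| > T) at most a large power
(of order n^(d/2)) of a number not above u, and the decay estimate bounds the
contribution by n * n^(- d g / 2) psi(u), up to constants.  Both exponents of n
are below 1 ([opnorm_le_powR]).

Conversely the normalised indicator of [0, u] shows that the norm of A_n is at
least psi(P(S <> 0)) / psi(u), which is about psi(n u) / psi(u) for small u
([opnorm_ge_dilation]), and at least n psi((u/2)^n) / psi(u)
([opnorm_ge_power]).  Under either half of the second alternative one of these
exceeds n / 2 for suitable u, which no bound C n^q with q < 1 permits. *)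

(** * Layer-cake formula *)

Section layer_cake.
Local Open Scope ereal_scope.
Context {R : realType} d (T : measurableType d).
Notation leb := (@lebesgue_measure R).

Lemma measurable_subgraph (g : T -> \bar R) : measurable_fun setT g ->
  measurable [set p : T * measurableTypeR R | (0 <= p.2)%R /\ p.2%:E < g p.1].
Proof.
move=> mg.
rewrite (_ : mkset _ = ([set: T] `*` `[0%R, +oo[%classic) `&`
  (setT `&` [set p : T * measurableTypeR R | p.2%:E < g p.1])).
  apply: measurableI; first by apply: measurableX => //; exact: measurable_itv.
  apply: measurable_lte => //.
    by apply/measurable_EFinP; exact: measurable_snd.
  by apply: (measurableT_comp mg); exact: measurable_fst.
apply/seteqP; split=> -[w s]/=; rewrite ?in_itv/= ?andbT; first by case.
by case=> -[_ ?] [_ ?].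
Qed.

(** Tonelli on the subgraph of g. *)
Lemma layer_cake (mu : {sigma_finite_measure set T -> \bar R})
    (g : T -> \bar R) : measurable_fun setT g -> (forall w, 0 <= g w) ->
  \int[mu]_w g w = \int[leb]_(s in `[0%R, +oo[) mu [set w | s%:E < g w].
Proof.
move=> mg g0; have mS := measurable_subgraph mg.
set S := mkset _ in mS.
have := @indic_fubini_tonelli _ _ T (measurableTypeR R) R mu leb S mS.
rewrite indic_fubini_tonelli_FE// indic_fubini_tonelli_GE//= => HF.
transitivity (\int[mu]_x leb (xsection S x)).
  apply: eq_integral => w _.
  have [[r gr r0]|gr] : (exists2 r, g w = r%:E & (0 <= r)%R) \/ g w = +oo.
  - by move: (g0 w); case: (g w) => [r| |]//= r0; [left; exists r|right].
  - rewrite /xsection/=; rewrite (_ : mkset _ = `[0%R, r[%classic).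
      rewrite lebesgue_measure_itv/= lte_fin sube0 gr.
      by case: ltP => // rle0; congr EFin; apply/le_anti; rewrite rle0 r0.
    apply/seteqP; split => s /=; rewrite inE /S/= in_itv/= gr lte_fin.
      by case=> -> ->.
    by move=> /andP.
  - rewrite /xsection/=; rewrite (_ : mkset _ = `[0%R, +oo[%classic).
      by rewrite lebesgue_measure_itv/= gr ltry addye.
    apply/seteqP; split => s /=; rewrite inE /S/= in_itv/= gr ltry andbT.
      by case.
    by [].
rewrite HF [RHS]integral_mkcond; apply: eq_integral => s _ /=.
rewrite patchE mem_setE in_itv/= andbT; case: ifPn => s0.
  congr (mu _); apply/seteqP; split => w; rewrite /ysection/= inE /S/=; first by case.
  by [].
rewrite (_ : ysection S s = set0) ?measure0//.
by apply/seteqP; split => w//=; rewrite /ysection/= inE /S/= => -[]; rewrite (negPf s0).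
Qed.

Lemma layer_cake_in (mu : {sigma_finite_measure set T -> \bar R}) (D : set T)
    (g : T -> \bar R) : measurable D -> measurable_fun D g ->
    (forall w, 0 <= g w) ->
  \int[mu]_(w in D) g w =
  \int[leb]_(s in `[0%R, +oo[) mu (D `&` [set w | s%:E < g w]).
Proof.
move=> mD mg g0; rewrite integral_mkcond layer_cake//.
- apply: eq_integral => s; rewrite inE/= in_itv/= andbT => s0.
  congr (mu _); apply/seteqP; split => w/=; rewrite patchE; case: ifPn.
  + by rewrite inE.
  + by move=> _; rewrite lte_fin ltNge s0.
  + by move=> _ [].
  + by rewrite notin_setE => nD [].
- exact/(measurable_restrictT _ mD).
- by move=> w; apply: erestrict_ge0 => ? _; exact: g0.
Qed.

End layer_cake.

(** * The measure dpsi *)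

Section psi_measure.
Context {R : realType} (psi : Psi R).

Lemma psi_extE (x : R) : 0 <= x <= 1 -> psi_ext psi x = psi x.
Proof.
by move=> /andP[x0 x1]; rewrite /psi_ext /clamp01 (min_idPl x1) (max_idPr x0).
Qed.

Lemma dpsi_itvoc (a b : R) : a <= b ->
  dpsi psi `]a, b]%classic = (psi_ext psi b - psi_ext psi a)%:E.
Proof.
move=> ab; rewrite /dpsi/= /lebesgue_stieltjes_measure/= /measure_extension/=.
rewrite measurable_mu_extE; first exact: (wlength_itv_bnd (psi_ext psi) false false ab).
exact: is_ocitv.
Qed.

Lemma dpsi_set1 (p : R) : dpsi psi [set p] = 0%E.
Proof.
apply/eqP; rewrite eq_le measure_ge0 andbT.
apply/lee_addgt0Pr => e e0; rewrite add0e.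
have /cvgrPdist_lt/(_ e e0) := @psi_ext_continuous R psi p.
move=> /nbhs_ballP[d /= d0 pd].
have d2 : 0 < d / 2 by rewrite divr_gt0.
have /= := pd (p - d / 2).
rewrite /ball/= opprD opprK addrA subrr add0r gtr0_norm// ltr_pdivrMr//.
rewrite ltr_pMr// ltr1n => /(_ isT) H.
apply: (@le_trans _ _ (dpsi psi `]p - d / 2, p]%classic)).
  apply: le_measure; rewrite ?inE//.
  by move=> _ /= ->; rewrite in_itv/= lexx ltrBlDr ltrDl d2.
rewrite dpsi_itvoc ?lerBlDr ?lerDl ?ltW//.
by rewrite lte_fin (le_lt_trans (ler_norm _)).
Qed.

(** The measure dpsi has no atoms, psi being continuous; hence the half-open
interval has the mass psi p - psi 0. *)
Lemma dpsi_itvco (p : R) : 0 <= p <= 1 ->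
  dpsi psi (`[0, 1] `&` [set t | t < p])%classic = (psi p)%:E.
Proof.
move=> p01; have /andP[p0 p1] := p01.
have m0 : dpsi psi `](-1), 0]%classic = 0%E.
  rewrite dpsi_itvoc ?lerN10// (psi_extE (x := 0)) ?lexx ?ler01//.
  by rewrite /psi_ext /clamp01 max_l ?ge_min ?lerN10// psi0 subrr.
apply/eqP; rewrite eq_le; apply/andP; split.
  rewrite -(psi_extE p01) -[X in X%:E]subr0 -[X in (_ - X)%:E](psi0 psi).
  rewrite -[X in (_ - X)%:E](psi_extE (x := 0)) ?lexx ?ler01//.
  rewrite -dpsi_itvoc// -[leRHS]adde0 -(dpsi_set1 0).
  apply: (le_trans _ (measureU2 _ _ _)).
  - apply: le_measure; rewrite ?inE//.
    + apply: measurableI; first exact: measurable_itv.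
      by rewrite -set_itvNyo; exact: measurable_itv.
    + by apply: measurableU; [exact: measurable_itv|exact: measurable_set1].
    + move=> t /=; rewrite !in_itv/= => -[/andP[t0 _] tp].
      by move: t0; rewrite le_eqVlt => /predU1P[<-|t0]; [right|left; rewrite t0 ltW].
  - exact: measurable_itv.
  - exact: measurable_set1.
rewrite -(psi_extE p01) -[X in X%:E]subr0 -[X in (_ - X)%:E](psi0 psi).
rewrite -[X in (_ - X)%:E](psi_extE (x := 0)) ?lexx ?ler01//.
rewrite -dpsi_itvoc// -[leRHS]adde0 -(dpsi_set1 p).
have mI : measurable (`[0, 1] `&` [set t : R | t < p])%classic.
  apply: measurableI; first exact: measurable_itv.
  by rewrite -set_itvNyo; exact: measurable_itv.
apply: (le_trans _ (measureU2 _ _ _)) => //.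
apply: le_measure; rewrite ?inE//; first by apply: measurableU.
move=> t /=; rewrite !in_itv/= => /andP[t0].
rewrite le_eqVlt => /predU1P[->|tp]; [by right|left; split=> //].
by rewrite ltW//= (le_trans (ltW tp)).
Qed.

End psi_measure.

(** * Rearrangements and distribution functions *)

Definition tail (R : realType) d (T : measurableType d) (P : set T -> \bar R)
    (x : T -> \bar R) (s : R) : R :=
  fine (P [set w | s%:E < `|x w|]%E).

Section rearrangement.
Local Open Scope ereal_scope.
Context {R : realType} d (T : measurableType d) (P : probability T R).
Variable x : T -> \bar R.
Hypothesis mx : measurable_fun setT x.

Lemma measurable_tail (s : \bar R) : measurable [set w | s < `|x w|].
Proof.
rewrite -[X in measurable X]setTI; apply: emeasurable_fun_o_infty => //.
exact: measurableT_comp.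
Qed.

(** The rearrangement is the generalised inverse of the distribution function; the
equivalence rests on the right-continuity of the latter, that is, on
continuity of P along the increasing events |x| > s + 1 / (k + 1). *)
Lemma rearrangement_gt (s t : R) : (0 <= s)%R ->
  (s%:E < rearrangement P x t) = (t%:E < P [set w | s%:E < `|x w|]).
Proof.
move=> s0; apply/idP/idP; apply: contraTT; rewrite -!leNgt => H.
  by apply: ereal_inf_lbound; exists s.
have Pt k : P [set w | (s + k.+1%:R^-1)%:E < `|x w|] <= t%:E.
  have : rearrangement P x t < (s + k.+1%:R^-1)%:E.
    by apply: (le_lt_trans H); rewrite lte_fin ltrDl.
  move=> /ereal_inf_lt[_ [r [r0 rt] <-]]; rewrite lte_fin => rs.
  apply: le_trans rt; apply: le_measure; rewrite ?inE; do ?exact: measurable_tail.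
  by move=> w /=; apply: le_lt_trans; rewrite lee_fin ltW.
pose F k := [set w | (s + k.+1%:R^-1)%:E < `|x w|].
have FE : \bigcup_k F k = [set w | s%:E < `|x w|].
  apply/seteqP; split => [w [k _]|w /=].
    by apply: le_lt_trans; rewrite lee_fin lerDl.
  case E: (`|x w|) => [r| |]//.
    rewrite lte_fin => /ltr_add_invr[k kr].
    by exists k => //=; rewrite /F/= E lte_fin.
  by move=> _; exists 0%N => //=; rewrite /F/= E ltry.
have : P \o F @ \oo --> P (\bigcup_k F k).
  apply: nondecreasing_cvg_mu.
  - by move=> k; exact: measurable_tail.
  - by rewrite FE; exact: measurable_tail.
  - move=> m n mn; rewrite subsetEset => w; apply: le_lt_trans.
    by rewrite lee_fin lerD2l lef_pV2 ?posrE// ler_nat ltnS.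
rewrite FE => PF; rewrite -(cvg_lim _ PF)//; apply: lime_le.
  by apply/cvg_ex; eexists; exact: PF.
by apply: nearW => k; exact: Pt.
Qed.

Lemma rearrangement_ge0 (t : R) : 0 <= rearrangement P x t.
Proof. by apply: le_ereal_inf_tmp => _ [s [s0 _] <-]; rewrite lee_fin. Qed.

Lemma tailE (s : R) : (tail P x s)%:E = P [set w | s%:E < `|x w|].
Proof. by rewrite fineK// fin_num_measure//; exact: measurable_tail. Qed.

Lemma tail_itv (s : R) : (0 <= tail P x s <= 1)%R.
Proof.
by rewrite fine_ge0//= -lee_fin tailE probability_le1//; exact: measurable_tail.
Qed.

Lemma measurable_rearrangement : measurable_fun setT (rearrangement P x).
Proof.
apply: (measurability _ (ErealGenOInfty.measurableE R)).
move=> /= _ [_ [a ->]] <-; rewrite setTI preimage_itvoy.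
have [a0|a0] := leP 0%R a.
  rewrite (_ : mkset _ = [set` `]-oo, tail P x a[]).
    exact: measurable_itv.
  apply/seteqP; split => t /=;
    by rewrite rearrangement_gt// in_itv/= -lte_fin tailE.
rewrite (_ : mkset _ = setT)//; apply/seteqP; split => t//= _.
by apply: (@lt_le_trans _ _ 0); rewrite ?lte_fin// rearrangement_ge0.
Qed.

End rearrangement.

Section lorentz_formula.
Local Open Scope ereal_scope.
Context {R : realType} (psi : Psi R).
Notation leb := (@lebesgue_measure R).

(** The Lorentz norm written through the distribution function only. *)
Definition tail_integral d (T : measurableType d) (P : set T -> \bar R)
    (x : T -> \bar R) : \bar R :=
  \int[leb]_(s in `[0%R, +oo[) (psi (tail P x s))%:E.

(** Layer cake for dpsi: the times t at which the rearrangement exceeds s form an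
interval starting at 0, of length P (|x| > s). *)
Lemma integral_rearrangement d (T : measurableType d) (P : probability T R)
    (x : T -> \bar R) : measurable_fun setT x ->
  \int[dpsi psi]_(t in `[0%R, 1%R]) rearrangement P x t = tail_integral P x.
Proof.
move=> mx; rewrite /dpsi.
rewrite (@layer_cake_in R _ (measurableTypeR R)) //; last 2 first.
- by apply: measurable_funTS; exact: measurable_rearrangement.
- by move=> t; exact: rearrangement_ge0.
rewrite -/(dpsi psi); apply: eq_integral => s; rewrite inE/= in_itv/= andbT => s0.
rewrite -dpsi_itvco ?tail_itv//; congr (dpsi psi _); congr setI.
by apply/seteqP; split => t /=;
  rewrite rearrangement_gt// -lte_fin tailE.
Qed.

Lemma leb01_lt (p : R) : (0 <= p <= 1)%R ->
  leb01 [set t : R | (t < p)%R] = p%:E.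
Proof.
move=> /andP[p0 p1]; rewrite /leb01 /mrestr.
rewrite (_ : _ `&` _ = `[0%R, p[%classic).
  rewrite lebesgue_measure_itv/= lte_fin oppr0 adde0; case: ltP => // p0'.
  by congr EFin; apply/le_anti; rewrite p0' p0.
apply/seteqP; split => t /=; rewrite !in_itv/=; first by move=> [tp /andP[-> _]].
by move=> /andP[-> tp]; split=> //=; rewrite ltW// (lt_le_trans tp).
Qed.

Lemma lorentz_normE (x : R -> \bar R) : measurable_fun setT x ->
  lorentz_norm psi x = tail_integral leb01 x.
Proof.
exact: (@integral_rearrangement _ (measurableTypeR R)
  (leb01 : probability (measurableTypeR R) R) x).
Qed.

(** A function and its rearrangement have the same distribution function. *)
Lemma lorentz_norm_onE d (T : measurableType d) (P : probability T R)
    (f : T -> R) : measurable_fun setT f ->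
  lorentz_norm_on psi P f = tail_integral P (EFin \o f).
Proof.
move=> mf; have mf' : measurable_fun setT (EFin \o f) by exact/measurable_EFinP.
rewrite /lorentz_norm_on lorentz_normE; last exact: measurable_rearrangement.
apply: eq_integral => s; rewrite inE/= in_itv/= andbT => s0.
congr (psi _)%:E; rewrite {1}/tail.
have -> : [set t : R | s%:E < `|rearrangement P (EFin \o f) t|] =
    [set t : R | (t < tail P (EFin \o f) s)%R].
  apply/seteqP; split => t /=; rewrite gee0_abs ?rearrangement_ge0//;
    by rewrite rearrangement_gt// -lte_fin tailE.
by rewrite leb01_lt// tail_itv.
Qed.

End lorentz_formula.

(** * Concavity of psi and dominated measures *)

Section psi_concavity.
Context {R : realType} (psi : Psi R).

Lemma le_psi (x y : R) : 0 <= x -> x <= y -> y <= 1 -> psi x <= psi y.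
Proof.
move=> x0 xy y1; apply: psi_nd => //; rewrite in_itv/=.
  by rewrite x0 (le_trans xy).
by rewrite y1 (le_trans x0).
Qed.

Lemma psi_ge0 (x : R) : 0 <= x <= 1 -> 0 <= psi x.
Proof. by move=> /andP[x0 x1]; rewrite -(psi0 psi) le_psi. Qed.

Lemma psi_concaveP (x y t : R) : 0 <= x <= 1 -> 0 <= y <= 1 -> 0 <= t <= 1 ->
  t * psi x + (1 - t) * psi y <= psi (t * x + (1 - t) * y).
Proof. by move=> x01 y01 t01; apply: psi_concave; rewrite in_itv. Qed.

Lemma psi_scale (c x : R) : 0 <= c <= 1 -> 0 <= x <= 1 ->
  c * psi x <= psi (c * x).
Proof.
move=> c01 x01; have := @psi_concaveP x 0 c x01 _ c01.
by rewrite lexx ler01 (psi0 psi) !mulr0 !addr0; exact.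
Qed.

Lemma psi_gt0 (x : R) : 0 < x -> x <= 1 -> 0 < psi x.
Proof.
move=> x0 x1; have := @psi_scale x 1.
rewrite (ltW x0) x1 ler01 lexx mulr1 => /(_ isT isT); apply: lt_le_trans.
by rewrite mulr_gt0// psi1_gt0.
Qed.

(** The points a + b and p are convex combinations of a and p + b with
complementary weights; adding the two concavity inequalities gives the claim. *)
Lemma psi_increment (a p b : R) : 0 <= a -> a <= p -> 0 <= b -> p + b <= 1 ->
  psi (p + b) - psi p <= psi (a + b) - psi a.
Proof.
move=> a0 ap b0 pb1.
have [pba|ne] := eqVneq (p + b) a.
  have [-> ->] : b = 0 /\ p = a by split; lra.
  exact: lexx.
have D0 : 0 < p + b - a by rewrite lt_neqAle eq_sym subr_eq0 ne/=; lra.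
pose t := b / (p + b - a).
have t01 : 0 <= t <= 1.
  by rewrite divr_ge0 ?(ltW D0)//= ler_pdivrMr// mul1r; lra.
have tD : t * (p + b - a) = b by rewrite /t divfK// gt_eqF.
have a01 : 0 <= a <= 1 by rewrite a0/=; lra.
have pb01 : 0 <= p + b <= 1 by rewrite pb1 andbT; lra.
have t01' : 0 <= 1 - t <= 1 by lra.
have := psi_concaveP pb01 a01 t01.
have -> : t * (p + b) + (1 - t) * a = a + b by rewrite -[in RHS]tD; ring.
have := psi_concaveP pb01 a01 t01'.
have -> : (1 - t) * (p + b) + (1 - (1 - t)) * a = p.
  by transitivity (p + b - t * (p + b - a)); [ring|rewrite tD; ring].
lra.
Qed.

Lemma psi_chord (p q b : R) : 0 <= p -> q <= 1 -> 0 <= b -> b <= q - p ->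
  (psi q - psi p) / (q - p) * b <= psi (p + b) - psi p.
Proof.
move=> p0 q1 b0 bqp.
have [qp|qp] := eqVneq (q - p) 0.
  have -> : b = 0 by lra.
  by rewrite mulr0 addr0 subrr.
have D0 : 0 < q - p by rewrite lt_neqAle eq_sym qp/=; lra.
pose t := b / (q - p).
have t01 : 0 <= t <= 1 by rewrite divr_ge0 ?(ltW D0)//= ler_pdivrMr// mul1r.
have tD : t * (q - p) = b by rewrite /t divfK// gt_eqF.
have := @psi_concaveP q p t _ _ t01.
have -> : t * q + (1 - t) * p = p + b by rewrite -tD; ring.
move=> H; have {}H := H ltac:(lra) ltac:(lra).
have -> : (psi q - psi p) / (q - p) * b = t * (psi q - psi p) by rewrite /t; ring.
lra.
Qed.

End psi_concavity.

Section dominated_measures.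
Local Open Scope ereal_scope.
Context {R : realType} (psi : Psi R) d (T : measurableType d).
Context (P : probability T R).
Notation leb := (@lebesgue_measure R).

(** The positive part of the unit ball of the dual of the Lorentz space. *)
Definition dominated (nu : set T -> \bar R) :=
  forall A, measurable A -> nu A <= (psi (fine (P A)))%:E.

Lemma fine_prob_itv (A : set T) : measurable A -> (0 <= fine (P A) <= 1)%R.
Proof.
move=> mA; rewrite fine_ge0//= -lee_fin fineK ?fin_num_measure//.
exact: probability_le1.
Qed.

Lemma fine_probU (A B : set T) : measurable A -> measurable B -> [disjoint A & B] ->
  fine (P (A `|` B)) = (fine (P A) + fine (P B))%R.
Proof.
move=> mA mB AB; rewrite measureU//; last exact/disj_set2P.
by rewrite fineD// fin_num_measure.
Qed.

Lemma le_fine_prob (A B : set T) : measurable A -> measurable B -> A `<=` B ->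
  (fine (P A) <= fine (P B))%R.
Proof.
move=> mA mB AB; rewrite fine_le ?fin_num_measure//.
by apply: le_measure; rewrite ?inE.
Qed.

(** One set of the chain is added at a time: on the new shell the measure is a
multiple of P, the factor being the slope of the chord of psi over the shell.
Concavity says that the increments of psi shrink, so that domination survives. *)
Lemma chain_measure (E : nat -> set T) (m : nat) :
    (forall i, measurable (E i)) -> (forall i, E i `<=` E i.+1) ->
    E 0%N = set0 ->
  exists nu : {measure set T -> \bar R}, dominated nu /\
    forall i, (i <= m)%N -> nu (E i) = (psi (fine (P (E i))))%:E.
Proof.
move=> mE EE E0.
suff [nu [nuP nuE _]] : exists nu : {measure set T -> \bar R},
    [/\ dominated nu,
        forall i, (i <= m)%N -> nu (E i) = (psi (fine (P (E i))))%:E &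
        forall A, measurable A -> nu A = nu (A `&` E m)].
  by exists nu.
elim: m => [|m [nu [nuP nuE nus]]].
  exists mzero; split => //.
  - by move=> A mA; rewrite /mzero lee_fin psi_ge0// fine_prob_itv.
  - by move=> i; rewrite leqn0 => /eqP ->; rewrite E0 !measure0/= psi0.
have EmS i j : (i <= j)%N -> E i `<=` E j.
  move=> /subnK <-; elim: (j - i)%N => // k IH.
  by apply: (subset_trans IH); rewrite addSn; exact: EE.
set D := E m.+1 `\` E m.
have mD : measurable D by exact: measurableD.
pose p := fine (P (E m)); pose q := fine (P (E m.+1)).
have [p0 p1] : (0 <= p)%R /\ (p <= 1)%R := andP (fine_prob_itv (mE m)).
have [q0 q1] : (0 <= q)%R /\ (q <= 1)%R := andP (fine_prob_itv (mE m.+1)).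
have PD : fine (P D) = (q - p)%R.
  rewrite /q -(setDUK (EE m)) fine_probU//; first by rewrite addrAC subrr add0r.
  by apply/disj_set2P; rewrite setDIK.
have pq : (p <= q)%R by rewrite -subr_ge0 -PD fine_ge0.
have c0 : (0 <= (psi q - psi p) / (q - p))%R.
  by rewrite divr_ge0 ?subr_ge0// le_psi.
(* If p = q the shell is null, and the division by zero makes the slope 0. *)
pose c := NngNum c0.
pose nu' : {measure set T -> \bar R} := measure_add nu (mscale c (mrestr P mD)).
have nu'E A : nu' A = nu A + ((psi q - psi p) / (q - p))%:E * P (A `&` D).
  exact: measure_addE.
have nu'm A : measurable A -> A `<=` E m -> nu' A = nu A.
  move=> mA AE; rewrite nu'E (_ : A `&` D = set0) ?measure0 ?mule0 ?adde0//.
  by apply/seteqP; split => // w [/AE ? []].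
exists nu'; split.
- move=> A mA; rewrite nu'E nus//.
  apply: (le_trans (leeD2r _ (nuP _ (measurableI _ _ mA (mE m))))).
  have mAD : measurable (A `&` D) by exact: measurableI.
  have mAE : measurable (A `&` E m) by exact: measurableI.
  rewrite -(fineK (fin_num_measure P _ mAD)) -EFinM -EFinD lee_fin.
  set a := fine (P (A `&` E m)); set b := fine (P (A `&` D)).
  have ap : (a <= p)%R by apply: le_fine_prob => // w [].
  have bqp : (b <= q - p)%R by rewrite -PD; apply: le_fine_prob => // w [].
  have [a0 a1] : (0 <= a)%R /\ (a <= 1)%R := andP (fine_prob_itv mAE).
  have [b0 b1] : (0 <= b)%R /\ (b <= 1)%R := andP (fine_prob_itv mAD).
  have abA : (a + b <= fine (P A))%R.
    rewrite -fine_probU//.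
      apply: le_fine_prob => //; first exact: measurableU.
      by move=> w [[]|[]].
    by apply/disj_set2P/seteqP; split => // w [[_ ?] [_ []]].
  have pb1 : (p + b <= 1)%R by lra.
  have := psi_chord psi p0 q1 b0 bqp.
  have := psi_increment psi a0 ap b0 pb1.
  have := le_psi psi (addr_ge0 a0 b0) abA (andP (fine_prob_itv mA)).2.
  rewrite -/p -/q; lra.
- move=> i; rewrite leq_eqVlt => /predU1P[->|]; last first.
    by rewrite ltnS => im; rewrite nu'm ?nuE//; exact: EmS.
  rewrite nu'E nus// (setIidr (EE m)) nuE//.
  rewrite (setIidr (@subDsetl _ _ _)) -(fineK (fin_num_measure P _ mD)) PD.
  rewrite -EFinM -EFinD -/p -/q; congr EFin.
  have [qp|qp] := eqVneq (q - p)%R 0%R; last by rewrite divfK// subrKC.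
  by rewrite qp mulr0 addr0; congr (psi _); lra.
- move=> A mA; rewrite !nu'E [in LHS]nus// [in RHS]nus; last exact: measurableI.
  congr (nu _ + _ * P _); apply/seteqP; split => w; rewrite /D/=.
    by move=> [Aw Ew]; do !split => //; exact: EE.
    by move=> [[]].
  by move=> [Aw [? ?]].
  by move=> [[]].
Qed.

End dominated_measures.

(** * Lorentz norm as a supremum over dominated measures *)

Section riemann_bound.
Local Open Scope ereal_scope.
Context {R : realType} (phi : R -> R).
Hypothesis phi_ge0 : forall s, (0 <= phi s)%R.
Hypothesis phi_ni : nonincreasing_fun phi.
Notation leb := (@lebesgue_measure R).

Lemma integral_le_upper_sum (delta : R) (m : nat) : (0 < delta)%R ->
  \int[leb]_(s in `[0%R, (m%:R * delta)%R[) (phi s)%:E <=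
  (\sum_(i < m) delta * phi (i%:R * delta))%:E.
Proof.
move=> d0; have mphi D : measurable D -> measurable_fun D (EFin \o phi).
  by move=> mD; apply/measurable_EFinP; exact: nonincreasing_measurable.
elim: m => [|m IH]; first by rewrite mul0r set_itvco0 integral_set0 big_ord0.
have md : (m%:R * delta <= m.+1%:R * delta)%R by rewrite ler_pM2r// ler_nat.
rewrite (_ : `[0%R, _[%classic = `[0%R, (m%:R * delta)%R[ `|`
    `[(m%:R * delta)%R, (m.+1%:R * delta)%R[); last first.
  apply/seteqP; split => s /=; rewrite !in_itv/=.
    by case: (ltP s (m%:R * delta)%R) => sm /andP[-> ?]; [left|right].
  move=> [/andP[-> sm]|/andP[ms ->]]; first by rewrite (lt_le_trans sm).
  by rewrite andbT (le_trans _ ms)// mulr_ge0// ltW.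
rewrite ge0_integral_setU//=; last 3 first.
- by apply: mphi; exact: measurableU.
- by move=> s _; rewrite lee_fin.
- apply/disj_set2P/seteqP; split => // s [/=]; rewrite !in_itv/= => /andP[_ sm].
  by rewrite leNgt sm.
rewrite big_ord_recr/= EFinD leeD// (mulrC delta).
apply: (@le_trans _ _ (\int[leb]_(s in `[(m%:R * delta)%R, (m.+1%:R * delta)%R[)
    (phi (m%:R * delta))%:E)).

  apply: ge0_le_integral => //=.
  - by move=> s _; rewrite lee_fin.
  - exact: mphi.
  - by move=> s; rewrite in_itv/= => /andP[ms _]; rewrite lee_fin phi_ni.
rewrite integral_cst//= lebesgue_measure_itv/= lte_fin; case: ifP => _.
  by rewrite -EFinB -EFinM -mulrBl -natrB// subSnn mul1r.
by rewrite mule0 lee_fin mulr_ge0// ltW.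
Qed.

(** For a monotone integrand upper and lower sums of mesh delta differ by at most
delta * phi 0, which disappears as delta tends to 0. *)
Lemma integral_le_lower_sums (B : \bar R) :
    (forall (delta : R) (m : nat), (0 < delta)%R ->
      (\sum_(i < m) delta * phi (i.+1%:R * delta))%:E <= B) ->
  \int[leb]_(s in `[0%R, +oo[) (phi s)%:E <= B.
Proof.
move=> HB; have mphi : measurable_fun setT phi.
  exact: nonincreasing_measurable.
rewrite ge0_integral_ereal_sup//; apply: ge_ereal_sup => _ [n _ <-].
apply/lee_addgt0Pr => e e0.
set M : R := n.+2%:R.
(* So many steps that delta * phi 0 is at most e. *)
pose m := Num.truncn (M * phi 0 / e).
pose delta : R := (M / m.+1%:R)%R.
have d0 : (0 < delta)%R by rewrite divr_gt0.
apply: (@le_trans _ _ (\int[leb]_(s in `[0%R, (m.+1%:R * delta)%R[) (phi s)%:E)).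
  apply: ge0_subset_integral => //=.
  - by apply/measurable_EFinP; exact: measurable_funTS.
  - by move=> s _; rewrite lee_fin.
  - move=> s /=; rewrite !in_itv/= /delta mulrC divfK ?pnatr_eq0// => /andP[-> sn].
    by rewrite (le_lt_trans sn)// ltr_nat.
apply: (le_trans (integral_le_upper_sum _ d0)).
rewrite big_ord_recl/= mul0r EFinD addeC leeD//; first exact: HB.
rewrite lee_fin /delta mulrAC ler_pdivrMr// (mulrC e) -ler_pdivrMr// ltW//.
exact: truncnS_gt.
Qed.

End riemann_bound.

Section duality.
Local Open Scope ereal_scope.
Context {R : realType} (psi : Psi R) d (T : measurableType d).
Context (P : probability T R).
Notation leb := (@lebesgue_measure R).

Lemma tail_nonincreasing (x : T -> \bar R) : measurable_fun setT x ->
  nonincreasing_fun (tail P x).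
Proof.
move=> mx s t st; apply: le_fine_prob; do ?exact: measurable_tail.
by move=> w /=; apply: le_lt_trans; rewrite lee_fin.
Qed.

Lemma psi_tail_nonincreasing (x : T -> \bar R) : measurable_fun setT x ->
  nonincreasing_fun (psi \o tail P x).
Proof.
move=> mx s t st /=; have [t0 _] := andP (tail_itv P mx t).
have [_ s1] := andP (tail_itv P mx s).
by rewrite le_psi// tail_nonincreasing.
Qed.

Lemma psi_tail_ge0 (x : T -> \bar R) : measurable_fun setT x ->
  forall s, (0 <= psi (tail P x s))%R.
Proof. by move=> mx s; rewrite psi_ge0// tail_itv. Qed.

Lemma sum_indic_multiples_le (delta y : R) m : (0 <= delta)%R -> (0 <= y)%R ->
  (\sum_(i < m) delta * (i.+1%:R * delta < y)%R%:R <= y)%R.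
Proof.
move=> d0 y0; suff /andP[] : ((\sum_(i < m) delta * (i.+1%:R * delta < y)%R%:R <= y) &&
    (\sum_(i < m) delta * (i.+1%:R * delta < y)%R%:R <= m%:R * delta))%R by [].
elim: m => [|m /andP[IHy IHm]]; first by rewrite big_ord0 mul0r y0/=.
rewrite big_ord_recr/=; have [lt|ge] := ltP; last first.
  by rewrite mulr0 addr0 IHy/= (le_trans IHm)// ler_wpM2r// ler_nat.
rewrite mulr1; suff le : (\sum_(i < m) delta * (i.+1%:R * delta < y)%R%:R + delta <=
    m.+1%:R * delta)%R by rewrite le andbT (le_trans le)// ltW.
by rewrite -natr1 mulrDl mul1r lerD2r.
Qed.

(** A lower sum of the layer-cake integral only involves the chain of events
|g| > i delta, on which a dominated measure may attain psi o P exactly; and the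
corresponding staircase function lies below |g|. *)
Lemma tail_integral_le_dual (g : T -> R) (B : \bar R) : measurable_fun setT g ->
    (forall nu : {finite_measure set T -> \bar R}, dominated psi P nu ->
      \int[nu]_w `|g w|%:E <= B) ->
  tail_integral psi P (EFin \o g) <= B.
Proof.
move=> mg HB; have mg' : measurable_fun setT (EFin \o g) by exact/measurable_EFinP.
apply: integral_le_lower_sums.
- exact: psi_tail_ge0.
- exact: psi_tail_nonincreasing.
move=> delta m d0.
(* Indexed backwards, so that the sets increase with j. *)
pose E j := if j is j'.+1 then
  [set w | ((m.+1 - j)%:R * delta)%:E < `|(EFin \o g) w|] else set0.
have mE j : measurable (E j).
  by case: j => [|j]; [exact: measurable0|exact: measurable_tail].
have EE j : E j `<=` E j.+1.
  case: j => [//|j] w /=; apply: le_lt_trans.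
  by rewrite lee_fin ler_pM2r// ler_nat leq_sub2l.
have [nu [nuP nuE]] := chain_measure psi P m mE EE erefl.
have nuT : nu setT < +oo by rewrite (le_lt_trans (nuP _ measurableT))// ltry.
pose nuF : {finite_measure set T -> \bar R} := mfrestr measurableT nuT.
have nuFE A : nuF A = nu A by rewrite -[in RHS](setIT A).
have nuFP : dominated psi P nuF by move=> A mA; rewrite nuFE; exact: nuP.
apply: (le_trans _ (HB nuF nuFP)).
pose F i := [set w | (i.+1%:R * delta)%:E < `|(EFin \o g) w|].
have mF i : measurable (F i) by exact: measurable_tail.
have EF (i : 'I_m) : E (m - i)%N = F i.
  have mi : (m.+1 - (m - i) = i.+1)%N.
    by rewrite subSn ?leq_subr// subKn// ltnW.
  rewrite /E; case mij : (m - i)%N => [|j].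
    by move/eqP: mij; rewrite subn_eq0 leqNgt ltn_ord.
  by rewrite -mij mi.
have -> : (\sum_(i < m) delta * (psi \o tail P (EFin \o g)) (i.+1%:R * delta))%:E =
    \int[nuF]_w \sum_(i < m) (delta%:E * (\1_(F i) w)%:E).
  rewrite ge0_integral_sum//; last 2 first.
  - by move=> i; apply/measurable_funeM/measurable_EFinP; exact: measurable_indic.
  - by move=> i w _; rewrite mule_ge0// lee_fin// ltW.
  rewrite -sumEFin; apply: eq_bigr => i _.
  rewrite ge0_integralZl_EFin ?ltW//; last first.
    by apply/measurable_EFinP; exact: measurable_indic.
  rewrite integral_indic// setIT EFinM; congr (_ * _).
  by apply: etrans (esym (nuFE (F i))); rewrite -EF nuE ?leq_subr// EF.
apply: ge0_le_integral => //.
- by move=> w _; apply: sume_ge0 => i _; rewrite mule_ge0// lee_fin// ltW.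
- apply: emeasurable_sum => i.
  by apply/measurable_funeM/measurable_EFinP; exact: measurable_indic.
- by apply/measurable_EFinP; exact: measurableT_comp.
- move=> w _; rewrite (eq_bigr (fun i : 'I_m =>
    (delta * (i.+1%:R * delta < `|g w|)%R%:R)%:E)); last first.
    move=> i _; rewrite EFinM indicE; congr (_ * (nat_of_bool _)%:R%:E).
    by apply/idP/idP; rewrite inE.
  by rewrite sumEFin lee_fin sum_indic_multiples_le// ltW.
Qed.

Lemma integral_le_tail_integral (nu : {finite_measure set T -> \bar R})
    (g : T -> R) : dominated psi P nu -> measurable_fun setT g ->
  \int[nu]_w `|g w|%:E <= tail_integral psi P (EFin \o g).
Proof.
move=> nuP mg; have mg' : measurable_fun setT (EFin \o g) by exact/measurable_EFinP.
have mt s : measurable [set w | s%:E < `|g w|%:E].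
  exact: (measurable_tail mg' s%:E).
rewrite layer_cake//; last exact/measurable_EFinP/measurableT_comp.
rewrite [leLHS](_ : _ = \int[leb]_(s in `[0%R, +oo[)
    (fine (nu [set w | s%:E < `|g w|%:E]%E))%:E); last first.
  by apply: eq_integral => s _; rewrite fineK// fin_num_measure.
apply: ge0_le_integral => //=.
- by move=> s _; rewrite lee_fin fine_ge0.
- apply/measurable_EFinP; apply: nonincreasing_measurable => // s t st.
  rewrite fine_le ?fin_num_measure//; apply: le_measure; rewrite ?inE//.
  by move=> w /=; apply: le_lt_trans; rewrite lee_fin.
- apply/measurable_EFinP; apply: nonincreasing_measurable => //.
  exact: psi_tail_nonincreasing.
- by move=> s _; rewrite fineK ?fin_num_measure//; exact: nuP.
Qed.

End duality.

(** * Reduction to signed indicators *)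

Section level_decomposition.
Local Open Scope ereal_scope.
Context {R : realType}.
Notation leb := (@lebesgue_measure R).
Notation TR := (measurableTypeR R).

(** For s >= 0 this is sgn y * 1_(s < |y|), so that y is the integral of its levels.
Being 0 for s < 0, it can be integrated over the whole line. *)
Definition level (y s : R) : R :=
  (Num.sg y * ((0 <= s) && (s < `|y|))%R%:R)%R.

Lemma levelE (y c s : R) :
  (level y s * c)%:E = (Num.sg y * c)%:E * (\1_(`[0%R, `|y|%R[%classic) s)%:E.
Proof. by rewrite -EFinM /level indicE mem_setE in_itv/= mulrAC. Qed.

Lemma integrable_level (y c : R) :
  leb.-integrable setT (fun s => (level y s * c)%:E).
Proof.
have iI := integrable_indic_itv 0%R `|y|%R true true.
apply: eq_integrable (integrableZl _ (Num.sg y * c) iI) => //.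
by move=> s _; rewrite levelE.
Qed.

Lemma integral_level (y c : R) : \int[leb]_s (level y s * c)%:E = (y * c)%:E.
Proof.
under eq_integral do rewrite levelE.
rewrite integralZl//; last exact: integrable_indic_itv.
rewrite integral_indic//= setIT lebesgue_measure_itv/= lte_fin normr_gt0.
have [->|y0] := eqVneq y 0%R; first by rewrite mule0 mul0r.
by rewrite -EFinB -EFinM subr0 mulrAC -numEsg.
Qed.

Lemma abs_sum_le_integral_level n (a c : 'I_n -> R) :
  `|\sum_(k < n) a k * c k|%:E <=
  \int[leb]_s `|\sum_(k < n) level (a k) s * c k|%:E.
Proof.
rewrite [leLHS](_ : _ = `|\int[leb]_s \sum_(k < n) (level (a k) s * c k)%:E|).
  apply: le_trans (le_abse_integral _ _ _) _ => //.
    apply: emeasurable_sum => k.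
    exact: (measurable_int _ (integrable_level (a k) (c k))).
  rewrite le_eqVlt; apply/orP; left; apply/eqP.
  by apply: eq_integral => s _; rewrite sumEFin.
rewrite integral_sum//; last by move=> k; exact: integrable_level.
by rewrite (eq_bigr _ (fun k _ => integral_level (a k) (c k))) sumEFin.
Qed.

Lemma level_norm (y s : R) : `|level y s|%R = (level y s != 0)%R%:R.
Proof.
rewrite /level mulf_eq0 negb_or sgr_eq0 pnatr_eq0.
case: (_ && _) => /=; rewrite ?mulr0 ?normr0 ?andbF// mulr1 andbT.
by rewrite normr_sg.
Qed.

Lemma sgr_nondecreasing : nondecreasing_fun (@Num.sg R).
Proof.
by move=> x y xy; case: (sgrP x) xy => // x0; case: (sgrP y) => // y0; lra.
Qed.

Lemma measurable_opA (r : R -> R) n (f : R -> R) :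
    measurable_fun setT r -> measurable_fun setT f ->
  measurable_fun setT (opA r f : n.-tuple (TR * TR)%type -> R).
Proof.
move=> mr mf; rewrite /opA; apply: measurable_sum => k.
apply: measurable_funM; apply: measurableT_comp => //.
  by apply: (measurableT_comp measurable_fst); exact: measurable_tnth.
by apply: (measurableT_comp measurable_snd); exact: measurable_tnth.
Qed.

Lemma measurable_opA_level (r : R -> R) n (f : R -> R) :
    measurable_fun setT r -> measurable_fun setT f ->
  measurable_fun setT (fun p : n.-tuple (TR * TR)%type * TR =>
    opA r (fun x => level (f x) p.2) p.1).
Proof.
move=> mr mf; rewrite /opA; apply: measurable_sum => k.
have mk : measurable_fun setT (fun p : n.-tuple (TR * TR)%type * TR => tnth p.1 k).
  exact: (measurableT_comp (measurable_tnth k) measurable_fst).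
have mfk : measurable_fun setT
    (fun p : n.-tuple (TR * TR)%type * TR => f (tnth p.1 k).1).
  exact: (measurableT_comp mf (measurableT_comp measurable_fst mk)).
apply: measurable_funM; last first.
  exact: (measurableT_comp mr (measurableT_comp measurable_snd mk)).
rewrite /level; apply: measurable_funM.
  by apply: (measurableT_comp _ mfk); exact: nondecreasing_measurable sgr_nondecreasing.
apply: (@measurableT_comp _ _ _ _ _ _ (fun b : bool => b%:R : R)) => //.
apply: measurable_and.
  by apply: measurable_fun_ler => //; exact: measurable_snd.
by apply: measurable_fun_ltr; [exact: measurable_snd|exact: measurableT_comp].
Qed.

End level_decomposition.

Section reduction.
Local Open Scope ereal_scope.
Context {R : realType} (psi : Psi R) (r : R -> R).
Hypothesis mr : measurable_fun setT r.
Notation leb := (@lebesgue_measure R).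
Notation TR := (measurableTypeR R).

(** Minkowski's integral inequality for the decomposition of f into levels: by
duality it is enough to integrate against a dominated measure, and there Tonelli
exchanges the two integrations. *)
Lemma tail_integral_opA_le n (K : R) (f : R -> R) : (0 <= K)%R ->
    (forall e : R -> R, measurable_fun setT e ->
      (forall x, `|e x| = (e x != 0)%:R)%R ->
      tail_integral psi (leb01_pow n) (EFin \o opA r e) <=
      (K * psi (fine (leb01 [set x | e x != 0%R])))%:E) ->
    measurable_fun setT f ->
  tail_integral psi (leb01_pow n) (EFin \o opA r f) <=
  K%:E * tail_integral psi leb01 (EFin \o f).
Proof.
move=> K0 He mf; have mf' : measurable_fun setT (EFin \o f) by exact/measurable_EFinP.
apply: tail_integral_le_dual; first exact: measurable_opA.
move=> nu nuP.
pose F (p : n.-tuple (TR * TR)%type * TR) : \bar R :=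
  `|opA r (fun x => level (f x) p.2) p.1|%:E.
have mF : measurable_fun setT F.
  apply/measurable_EFinP; apply: measurableT_comp => //.
  exact: measurable_opA_level.
have F0 p : 0 <= F p by rewrite lee_fin.
have mlev s : measurable_fun setT (fun x => level (f x) s).
  rewrite /level; apply: measurable_funM.
    by apply: (measurableT_comp _ mf); exact: nondecreasing_measurable sgr_nondecreasing.
  apply: (@measurableT_comp _ _ _ _ _ _ (fun b : bool => b%:R : R)) => //.
  apply: measurable_and => //; apply: measurable_fun_ltr => //.
  exact: measurableT_comp.
apply: (@le_trans _ _ (\int[nu]_w \int[leb]_s F (w, s))).
  apply: ge0_le_integral => //.
  - by apply/measurable_EFinP; apply: measurableT_comp => //; exact: measurable_opA.
  - exact: (measurable_fun_fubini_tonelli_F F).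
  - by move=> w _; exact: abs_sum_le_integral_level.
rewrite (fubini_tonelli F)//.
pose G (s : R) : R := if (0 <= s)%R then psi (tail leb01 (EFin \o f) s) else 0%R.
have G0 s : (0 <= G s)%R by rewrite /G; case: ifP => // _; exact: psi_tail_ge0.
have mG : measurable_fun setT G.
  apply: measurable_fun_ifT => //; first exact: measurable_fun_ler.
  by apply: nonincreasing_measurable => //; exact: psi_tail_nonincreasing.
apply: (@le_trans _ _ (\int[leb]_s (K%:E * (G s)%:E))).
  apply: ge0_le_integral => //.
  - by move=> s _; exact: integral_ge0.
  - exact: (measurable_fun_fubini_tonelli_G F).
  - exact/measurable_funeM/measurable_EFinP.
  - move=> s _.
    apply: le_trans (integral_le_tail_integral nuP (measurable_opA mr (mlev s))) _.
    apply: le_trans (He _ (mlev s) _) _; first by move=> x; exact: level_norm.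
    rewrite -EFinM lee_fin /G ler_wpM2l//; case: ifPn => s0; last first.
      rewrite (_ : [set x | _] = set0) ?measure0 ?psi0//.
      apply/seteqP; split => // x /=.
      by rewrite /level (negPf s0)/= mulr0 eqxx.
    rewrite /tail (_ : [set x | _] = [set w | s%:E < `|(EFin \o f) w|])//.
    apply/seteqP; split => x /=; rewrite lte_fin /level s0/= mulf_eq0 negb_or.
      by rewrite pnatr_eq0 eqb0 negbK => /andP[].
    move=> sf; rewrite sf/= oner_eq0 andbT sgr_eq0 -normr_gt0.
    exact: le_lt_trans sf.
rewrite ge0_integralZl_EFin//; last 2 first.
- by move=> s _; rewrite lee_fin.
- exact/measurable_EFinP.
rewrite /tail_integral [in leRHS]integral_mkcond le_eqVlt; apply/orP; left.
apply/eqP; congr (_ * _); apply: eq_integral => s _.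
by rewrite patchE mem_setE in_itv/= andbT /G; case: ifP.
Qed.

End reduction.

(** * Law of the sum for a signed indicator *)

Section product_expectation.
Local Open Scope ereal_scope.
Context {R : realType} d (T : measurableType d) (P : probability T R).

(** Independence of the coordinates, in the form used for all the laws below. *)
Lemma integral_power_prob n (phi : 'I_n -> T -> R) (a : 'I_n -> R) :
    (forall k, measurable_fun setT (phi k)) ->
    (forall k x, 0 <= phi k x)%R ->
    (forall k, \int[P]_x (phi k x)%:E = (a k)%:E) ->
  \int[power_prob P n]_w (\prod_(k < n) phi k (tnth w k))%:E =
  (\prod_(k < n) a k)%:E.
Proof.
elim: n phi a => [|n IH] phi a mphi phi0 phia.
  under eq_integral do rewrite big_ord0.
  by rewrite big_ord0 integral_cst//= mul1e diracT.
have mprod m (f : 'I_m -> T -> R) : (forall k, measurable_fun setT (f k)) ->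
    measurable_fun setT (fun w : m.-tuple T => (\prod_(k < m) f k (tnth w k))%:E).
  move=> mf; apply/measurable_EFinP; apply: measurable_prod => k _.
  exact: (measurableT_comp (mf k) (measurable_tnth k)).
rewrite /=.
rewrite ge0_integral_distribution//; last 2 first.
- exact: mprod.
- by move=> w; rewrite lee_fin prodr_ge0.
rewrite fubini_tonelli1//=; last 2 first.
- apply: measurableT_comp; first exact: mprod.
  exact: measurable_cons_pair.
- by move=> w; rewrite lee_fin prodr_ge0.
rewrite /fubini_F/=.
transitivity (\int[P]_x ((phi ord0 x)%:E * (\prod_(k < n) a (lift ord0 k))%:E)).
  apply: eq_integral => x _.
  rewrite -(IH (fun k => phi (lift ord0 k)) (fun k => a (lift ord0 k)))//.
  rewrite -ge0_integralZl_EFin//; last 2 first.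
  - by move=> w _; rewrite lee_fin prodr_ge0.
  - exact: (mprod n (fun k => phi (lift ord0 k))).
  apply: eq_integral => w _; rewrite -EFinM big_ord_recl; congr (_ * _)%:E.
  by apply: eq_bigr => k _; rewrite tnthS.
rewrite ge0_integralZr//; last 3 first.
- exact/measurable_EFinP.
- by move=> x _; rewrite lee_fin.
- rewrite lee_fin; apply: prodr_ge0 => k _.
  by rewrite -lee_fin -phia; apply: integral_ge0 => x _; rewrite lee_fin.
by rewrite phia -EFinM big_ord_recl.
Qed.

End product_expectation.

Lemma ge0_integral_indicD (R : realType) d (T : measurableType d)
    (mu : {measure set T -> \bar R}) (A B : set T) (a b : R) :
    measurable A -> measurable B -> 0 <= a -> 0 <= b ->
  (\int[mu]_x (a%:E * (\1_A x)%:E + b%:E * (\1_B x)%:E) =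
   a%:E * mu A + b%:E * mu B)%E.
Proof.
move=> mA mB a0 b0.
have m1 (C : set T) : measurable C -> measurable_fun setT (fun x => (\1_C x : R)%:E).
  by move=> mC; apply/measurable_EFinP; exact: measurable_indic.
have i0 (c : R) (C : set T) x : 0 <= c -> (0 <= c%:E * (\1_C x)%:E)%E.
  by move=> c0; rewrite mule_ge0// lee_fin.
have iZ (c : R) (C : set T) : measurable C -> 0 <= c ->
    (\int[mu]_x (c%:E * (\1_C x)%:E) = c%:E * mu C)%E.
  move=> mC c0; rewrite ge0_integralZl_EFin ?integral_indic ?setIT//.
  exact: m1.
rewrite ge0_integralD ?iZ//.
- by move=> x _; exact: i0.
- by apply: measurable_funeM; exact: m1.
- by move=> x _; exact: i0.
- by apply: measurable_funeM; exact: m1.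
Qed.

Section signed_indicator_law.
Local Open Scope ereal_scope.
Context {R : realType} (r : R -> R).
Hypothesis hr : centered_bernoulli r.
Notation TR := (measurableTypeR R).

Lemma measurable_bernoulli : measurable_fun setT r.
Proof. by case: hr. Qed.

(** The values other than 1 and -1 are taken on a null set. *)
Lemma integral_bernoulli (h : R -> R) : (forall y, 0 <= h y)%R ->
    measurable_fun setT h ->
  \int[leb01]_t (h (r t))%:E = ((h 1 + h (-1)) / 2)%:E.
Proof.
move=> h0 mh; have [mr r1 rN1] := hr.
have mA c : measurable [set t : TR | r t = c].
  by rewrite -[X in measurable X]setTI; exact: (mr measurableT [set c]).
set A := [set t : TR | r t = 1%R] in r1; set B := [set t : TR | r t = (-1)%R] in rN1.
have mA1 : measurable A by exact: mA.
have mB : measurable B by exact: mA.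
have AB : A `&` B = set0.
  apply/seteqP; split => // t [] /= rt1; rewrite /B/= rt1 => /eqP.
  by rewrite -subr_eq0 opprK -mulr2n pnatr_eq0.
have nC : leb01 (~` (A `|` B)) = 0.
  have mAB : measurable (A `|` B) by apply: measurableU; exact: mA.
  rewrite probability_setC//.
  rewrite measureU//.
  rewrite [X in _ - (X + _)]r1 [X in _ - (_ + X)]rN1 -EFinD.
  by congr EFin; lra.
rewrite (_ : ((h 1 + h (-1)) / 2)%:E =
  \int[leb01]_t ((h 1)%:E * (\1_A t)%:E + (h (-1)%R)%:E * (\1_B t)%:E)).
  apply: ge0_ae_eq_integral => //.
  - by apply/measurable_EFinP; exact: measurableT_comp.
  - apply: emeasurable_funD; apply/measurable_funeM/measurable_EFinP;
      exact: measurable_indic.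
  - by move=> t _; rewrite lee_fin.
  - by move=> t _; rewrite adde_ge0// mule_ge0// lee_fin.
  exists (~` (A `|` B)); split => //.
    by apply: measurableC; apply: measurableU; exact: mA.
  apply: subsetC => t tAB /= _; rewrite !indicE.
  case: tAB => rt.
    rewrite mem_set// memNset ?mule1 ?mule0 ?adde0 ?rt// => Bt.
    by have : (A `&` B) t by []; rewrite AB.
  rewrite (@mem_set _ B)// memNset ?mule1 ?mule0 ?add0e ?rt// => At.
  by have : (A `&` B) t by []; rewrite AB.
rewrite ge0_integral_indicD//.
rewrite [X in _ * X + _]r1 [X in _ + _ * X]rN1.
by rewrite -!EFinM -EFinD mulrDl.
Qed.

Variable e : R -> R.
Hypothesis me : measurable_fun setT e.
Hypothesis e01 : forall x, (`|e x| = (e x != 0)%:R)%R.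
Let u : R := fine (leb01 [set x | e x != 0%R]).

Lemma measurable_support : measurable [set x : TR | e x != 0%R].
Proof.
have := me measurableT (measurable_set1 0%R); rewrite setTI => m0.
rewrite (_ : mkset _ = ~` (e @^-1` [set 0%R])); first exact: measurableC.
by apply/seteqP; split => x /= /eqP.
Qed.

Lemma support_itv : (0 <= u <= 1)%R.
Proof. exact: fine_prob_itv measurable_support. Qed.

(** One summand of A_n e is 1 or -1 with probability u / 2 each, else 0. *)
Lemma integral_signed_indicator (h : R -> R) : (forall y, 0 <= h y)%R ->
    measurable_fun setT h ->
  \int[leb01 \x leb01]_p (h (e p.1 * r p.2))%:E =
  (u * ((h 1 + h (-1)) / 2) + (1 - u) * h 0)%:E.
Proof.
move=> h0 mh; have mr := measurable_bernoulli.
rewrite fubini_tonelli1/=; last 2 first.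
- apply/measurable_EFinP; apply: (measurableT_comp mh); apply: measurable_funM.
    exact: (measurableT_comp me measurable_fst).
  exact: (measurableT_comp mr measurable_snd).
- by move=> p; rewrite lee_fin.
rewrite /fubini_F/=.
set E := [set x : TR | e x != 0%R]; have mE : measurable E := measurable_support.
transitivity (\int[leb01]_x (((h 1 + h (-1)) / 2)%:E * (\1_E x)%:E +
    (h 0%R)%:E * (\1_(~` E) x)%:E)).
  apply: eq_integral => x _.
  have xE : (x \in E) = (e x != 0%R) by apply/idP/idP; rewrite inE.
  rewrite (integral_bernoulli (h := fun y => h (e x * y)%R))//; last first.
    by apply: (measurableT_comp mh); exact: measurable_funM.
  rewrite -!EFinM -EFinD !indicE in_setC xE mulr1 mulrN1.
  have := e01 x; have [-> _|ex0] := eqVneq (e x) 0%R.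
    by congr EFin; rewrite oppr0 /=; field.
  rewrite /=; have [e0|e0] := leP 0%R (e x).
    by rewrite ger0_norm// => ->; congr EFin; ring.
  rewrite ltr0_norm// => /eqP; rewrite eqr_oppLR => /eqP ->.
  by congr EFin; rewrite opprK; ring.
have c0 : (0 <= (h 1 + h (-1)) / 2)%R by rewrite divr_ge0// addr_ge0.
have mC : measurable (~` E) by exact: measurableC.
rewrite ge0_integral_indicD//.
have lE : leb01 E = u%:E by rewrite /u fineK// fin_num_measure.
have lC : leb01 (~` E) = (1 - u)%:E by rewrite probability_setC// [X in _ - X]lE -EFinB.
rewrite [X in _ * X + _]lE [X in _ + _ * X]lC.
by rewrite -!EFinM -EFinD; congr EFin; ring.
Qed.

End signed_indicator_law.

Section probability_bounds.
Local Open Scope ereal_scope.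
Context {R : realType} d (T : measurableType d) (P : probability T R).
Context (A : set T) (f : T -> R) (c : R).
Hypotheses (mA : measurable A) (mf : measurable_fun setT f).
Hypotheses (f0 : forall w, (0 <= f w)%R) (fc : \int[P]_w (f w)%:E = c%:E).

Let PAE : P A = \int[P]_w (\1_A w)%:E.
Proof. by rewrite integral_indic// setIT. Qed.

Lemma prob_le_integral : (forall w, A w -> (1 <= f w)%R) -> (fine (P A) <= c)%R.
Proof.
move=> Af; rewrite -lee_fin -fc fineK ?fin_num_measure//.
rewrite PAE; apply: ge0_le_integral => //.
- by apply/measurable_EFinP; exact: measurable_indic.
- exact/measurable_EFinP.
- move=> w _; rewrite lee_fin indicE; case: (boolP (w \in A)) => [|_]//=.
  by rewrite inE => /Af.
Qed.

Lemma integral_le_prob : (forall w, (f w <= \1_A w)%R) -> (c <= fine (P A))%R.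
Proof.
move=> fA; rewrite -lee_fin -fc fineK ?fin_num_measure//.
rewrite PAE; apply: ge0_le_integral => //.
- by move=> w _; rewrite lee_fin.
- exact/measurable_EFinP.
- by apply/measurable_EFinP; exact: measurable_indic.
- by move=> w _; rewrite lee_fin.
Qed.

End probability_bounds.

Section signed_indicator_sum.
Context {R : realType} (r : R -> R) (e : R -> R) (n : nat).
Hypothesis hr : centered_bernoulli r.
Hypothesis me : measurable_fun setT e.
Hypothesis e01 : forall x, (`|e x| = (e x != 0)%:R)%R.
Notation TR := (measurableTypeR R).
Let u : R := fine (leb01 [set x | e x != 0%R]).
Let X (p : TR * TR) : R := e p.1 * r p.2.
Let Q : probability (n.-tuple (TR * TR)%type) R := leb01_pow n.
Let S : n.-tuple (TR * TR)%type -> R := opA r e.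
Let mr := measurable_bernoulli hr.

Let u01 : 0 <= u <= 1 := support_itv me.

Let mX : measurable_fun setT X.
Proof.
apply: measurable_funM; first exact: (measurableT_comp me measurable_fst).
exact: (measurableT_comp mr measurable_snd).
Qed.

Let mS : measurable_fun setT S.
Proof. exact: measurable_opA. Qed.

Let mprod (h : 'I_n -> R -> R) : (forall k, measurable_fun setT (h k)) ->
  measurable_fun setT
    (fun w : n.-tuple (TR * TR)%type => \prod_(k < n) h k (X (tnth w k))).
Proof.
move=> mh; apply: measurable_prod => k _.
exact: (measurableT_comp (mh k) (measurableT_comp mX (measurable_tnth k))).
Qed.

Lemma integral_prod_signed_indicator (h : 'I_n -> R -> R) :
    (forall k y, 0 <= h k y) -> (forall k, measurable_fun setT (h k)) ->
  (\int[Q]_w (\prod_(k < n) h k (X (tnth w k)))%:E =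
   (\prod_(k < n) (u * ((h k 1 + h k (-1)) / 2) + (1 - u) * h k 0))%:E)%E.
Proof.
move=> h0 mh.
rewrite (integral_power_prob (phi := fun k p => h k (X p))
  (a := fun k => u * ((h k 1 + h k (-1)) / 2) + (1 - u) * h k 0))//.
- by move=> k; exact: (measurableT_comp (mh k) mX).
- by move=> k; exact: (integral_signed_indicator hr me e01 (h0 k) (mh k)).
Qed.

Let mbool (b : R -> bool) : measurable_fun setT b ->
  measurable_fun setT (fun y => (b y)%:R : R).
Proof.
by move=> mb; exact: (@measurableT_comp _ _ _ _ _ _ (fun c : bool => c%:R : R)).
Qed.

Let mtail s : measurable [set w | (s%:E < `|(EFin \o S) w|)%E].
Proof. by apply: measurable_tail; exact/measurable_EFinP. Qed.

(** Almost surely every summand is at most 1 in absolute value. *)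
Lemma tail_opA_eq0 (s : R) : n%:R <= s -> tail Q (EFin \o S) s = 0.
Proof.
move=> ns; apply/eqP; rewrite eq_le fine_ge0// andbT.
pose h (y : R) : R := (`|y| <= 1)%R%:R.
have mh : measurable_fun setT h.
  by apply: mbool; apply: measurable_fun_ler => //; exact: measurableT_comp.
have h0 (k : 'I_n) y : 0 <= h y by [].
have := integral_prod_signed_indicator h0 (fun=> mh).
rewrite [in RHS](eq_bigr (fun=> 1)); last first.
  move=> k _; rewrite /h normr1 normrN1 normr0 lexx ler01/=; lra.
rewrite big1// => hQ.
have := integral_le_prob (measurableC (mtail s)) (mprod (fun=> mh)) _ hQ.
rewrite probability_setC// fineB ?fin_num_measure//= => H.
suff : 1 <= 1 - tail Q (EFin \o S) s by lra.
apply: H => [w|w]; first exact: prodr_ge0.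
rewrite indicE in_setC; case: (boolP (w \in _)) => [|_]; last first.
  by apply: prodr_ile1 => k _; rewrite /h ler0n lern1 leq_b1.
move=> /set_mem/=; rewrite lte_fin ltNge => /negP nSs.
suff [k kh] : exists k, ~~ (`|X (tnth w k)| <= 1).
  by rewrite (bigD1 k)//= /h (negPf kh) mul0r.
apply/existsP; rewrite -negb_forall; apply/negP => /forallP H1; apply: nSs.
apply: le_trans ns; apply: (le_trans (ler_norm_sum _ _ _)).
rewrite -[n in n%:R]card_ord -sumr_const; apply: ler_sum => k _; exact: H1.
Qed.

(** The probability that all summands vanish is (1 - u)^n, at least 1 - n u. *)
Lemma tail_opA_le_union (s : R) : 0 <= s -> tail Q (EFin \o S) s <= n%:R * u.
Proof.
move=> s0.
pose h (y : R) : R := (y == 0)%:R.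
have mh : measurable_fun setT h.
  by apply: mbool; exact: measurable_fun_eqr.
have h0 (k : 'I_n) y : 0 <= h y by [].
have := integral_prod_signed_indicator h0 (fun=> mh).
rewrite [in RHS](eq_bigr (fun=> 1 - u)); last first.
  by move=> k _; rewrite /h eqxx oppr_eq0 oner_eq0/=; lra.
rewrite prodr_const card_ord => hQ.
have := integral_le_prob (measurableC (mtail s)) (mprod (fun=> mh)) _ hQ.
rewrite probability_setC// fineB ?fin_num_measure//= => H.
suff : (1 - u) ^+ n <= 1 - tail Q (EFin \o S) s.
  suff : 1 - n%:R * u <= (1 - u) ^+ n by lra.
  elim: n => [|m IH]; first by rewrite expr0; lra.
  rewrite exprS -natr1; have /andP[u0 u1] := u01.
  have : (1 - u) * (1 - m%:R * u) <= (1 - u) * (1 - u) ^+ m by rewrite ler_wpM2l//; lra.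
  have : 0 <= m%:R * u * u by rewrite !mulr_ge0.
  lra.
apply: H => [w|w]; first exact: prodr_ge0.
rewrite indicE in_setC; case: (boolP (w \in _)) => [|_]; last first.
  by apply: prodr_ile1 => k _; rewrite /h ler0n lern1 leq_b1.
move=> /set_mem/=; rewrite lte_fin => /(le_lt_trans s0); rewrite normr_gt0 => S0.
suff [k kh] : exists k, X (tnth w k) != 0.
  by rewrite (bigD1 k)//= /h (negPf kh) mul0r.
apply/existsP; rewrite -negb_forall; apply/negP => /forallP H1.
by move/eqP: S0; apply; apply: big1 => k _; exact/eqP/H1.
Qed.

(** Chernoff's bound, applied to S and to - S: E exp(l S) is (1 + u (cosh l - 1))^n. *)
Lemma tail_opA_exp (l s : R) : 0 <= l ->
  tail Q (EFin \o S) s <=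
  2 * expR (n%:R * u * ((expR l + expR (- l)) / 2 - 1) - l * s).
Proof.
move=> l0; set c := (expR l + expR (- l)) / 2 - 1.
have Ec (b : R) : b = l \/ b = - l ->
    (\int[Q]_w (expR (b * S w))%:E = ((1 + u * c) ^+ n)%:E)%E.
  move=> bl; pose h (y : R) : R := expR (b * y).
  have mh : measurable_fun setT h.
    by apply: measurableT_comp => //; exact: measurable_funM.
  have h0 (k : 'I_n) y : 0 <= h y by exact: expR_ge0.
  transitivity (\int[Q]_w (\prod_(k < n) h (X (tnth w k)))%:E)%E.
    by apply: eq_integral => w _; rewrite /h -expR_sum -mulr_sumr.
  rewrite (integral_prod_signed_indicator h0 (fun=> mh)).
  rewrite (eq_bigr (fun=> 1 + u * c)) ?prodr_const ?card_ord//.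
  move=> k _; rewrite /h /c mulr0 expR0 mulr1 mulrN1.
  by case: bl => ->; rewrite ?opprK; field.
have mE b : measurable_fun setT (fun w => expR (b * S w)).
  by apply: measurableT_comp => //; exact: measurable_funM.
(* f dominates the indicator of |S| > s. *)
pose f w := expR (- (l * s)) * (expR (l * S w) + expR (- l * S w)).
have mf : measurable_fun setT f.
  by apply: measurable_funM => //; apply: measurable_funD; exact: mE.
have f0 w : 0 <= f w by rewrite mulr_ge0 ?addr_ge0 ?expR_ge0.
have fQ : (\int[Q]_w (f w)%:E = (expR (- (l * s)) * (2 * (1 + u * c) ^+ n))%:E)%E.
  under eq_integral do rewrite /f EFinM EFinD.
  rewrite ge0_integralZl_EFin ?expR_ge0//; last 2 first.
  - by move=> w _; rewrite -EFinD lee_fin addr_ge0 ?expR_ge0.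
  - by apply: emeasurable_funD; apply/measurable_EFinP; exact: mE.
  rewrite ge0_integralD//; do ?[by move=> w _; rewrite lee_fin expR_ge0|
    by apply/measurable_EFinP; exact: mE].
  by rewrite !Ec; [rewrite -EFinD -EFinM -mulr2n mulr_natl|right|left].
apply: le_trans (prob_le_integral (mtail s) mf f0 fQ _) _ => [w /=|].
  rewrite lte_fin => sS; rewrite /f mulrDr -!expRD.
  have [S0|S0] := leP 0 (S w).
    apply: ler_wpDr; first exact: expR_ge0.
    rewrite -expR0 ler_expR; move: sS; rewrite ger0_norm// => sS.
    by rewrite addrC subr_ge0 ler_wpM2l// ltW.
  apply: ler_wpDl; first exact: expR_ge0.
  rewrite -expR0 ler_expR; move: sS; rewrite ltr0_norm// => sS.
  by rewrite addrC subr_ge0 mulNr -mulrN ler_wpM2l// ltW.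
rewrite mulrCA ler_wpM2l// expRD mulrC ler_wpM2r ?expR_ge0//.
have uc : 0 <= u * c.
  have /andP[u0 _] := u01; rewrite mulr_ge0// /c.
  have := expR_ge1Dx l; have := expR_ge1Dx (- l); lra.
rewrite -mulrA expRM_natl lerXn2r ?nnegrE ?expR_ge0 ?addr_ge0 ?expR_ge1Dx//.
Qed.

(** With probability (u / 2)^n every summand equals 1. *)
Lemma tail_opA_ge_all (s : R) : s < n%:R -> (u / 2) ^+ n <= tail Q (EFin \o S) s.
Proof.
move=> sn; pose h (y : R) : R := (y == 1)%:R.
have mh : measurable_fun setT h.
  by apply: mbool; exact: measurable_fun_eqr.
have h0 (k : 'I_n) y : 0 <= h y by [].
have := integral_prod_signed_indicator h0 (fun=> mh).
rewrite [in RHS](eq_bigr (fun=> u / 2)); last first.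
  move=> k _; rewrite /h eqxx (eq_sym 0) oner_eq0.
  by rewrite -subr_eq0 -opprD oppr_eq0 -mulr2n pnatr_eq0/=; lra.
rewrite prodr_const card_ord => hQ.
apply: (integral_le_prob (mtail s) (mprod (fun=> mh)) _ hQ) => [w|w].
  exact: prodr_ge0.
have [/forallP H|] := boolP [forall k, X (tnth w k) == 1]; last first.
  rewrite negb_forall => /existsP[k kh].
  by rewrite (bigD1 k)//= /h (negPf kh) mul0r.
rewrite big1 => [|k _]; last by rewrite /h H.
rewrite indicE mem_set//= lte_fin.
have -> : S w = n%:R.
  rewrite /S /opA -[n in RHS]card_ord -sumr_const.
  by apply: eq_bigr => k _; exact/eqP/H.
by rewrite ger0_norm.
Qed.

(** The events that the k-th summand is the only nonzero one are disjoint, and |S| is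
1 on each of them. *)
Lemma tail_opA_ge_one (s : R) : s < 1 ->
  n%:R * u * (1 - u) ^+ n.-1 <= tail Q (EFin \o S) s.
Proof.
move=> s1; pose h (k j : 'I_n) (y : R) : R :=
  if j == k then (`|y| == 1)%:R else (y == 0)%:R.
have mh k j : measurable_fun setT (h k j).
  rewrite /h; case: (j == k); apply: mbool; exact: measurable_fun_eqr.
have h0 k j y : 0 <= h k j y by rewrite /h; case: ifP.
have Eh k : (\int[Q]_w (\prod_(j < n) h k j (X (tnth w j)))%:E =
    (u * (1 - u) ^+ n.-1)%:E)%E.
  rewrite (integral_prod_signed_indicator (h0 k) (mh k)) (bigD1 k)//=.
  rewrite [X in _ * X](eq_bigr (fun=> 1 - u)) => [|j /negPf jk]; last first.
    by rewrite /h jk eqxx oppr_eq0 oner_eq0/=; lra.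
  rewrite prodr_const cardC1 card_ord /h eqxx normr1 normrN1 normr0 eqxx.
  by rewrite eq_sym oner_eq0 /=; congr EFin; field.
pose f w := \sum_(k < n) \prod_(j < n) h k j (X (tnth w j)).
have mf : measurable_fun setT f by apply: measurable_sum => k; exact: mprod.
have f0 w : 0 <= f w by apply: sumr_ge0 => k _; exact: prodr_ge0.
have fQ : (\int[Q]_w (f w)%:E = (n%:R * u * (1 - u) ^+ n.-1)%:E)%E.
  under eq_integral do rewrite /f -sumEFin.
  rewrite ge0_integral_sum//; last 2 first.
  - by move=> k; apply/measurable_EFinP; exact: mprod.
  - by move=> k w _; rewrite lee_fin prodr_ge0.
  rewrite (eq_bigr _ (fun k _ => Eh k)) sumEFin sumr_const card_ord.
  by congr EFin; rewrite -[LHS]mulr_natl mulrA.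
apply: (integral_le_prob (mtail s) mf f0 fQ) => w.
have [/existsP[k /forallP Hk]|] :=
    boolP [exists k, [forall j, h k j (X (tnth w j)) != 0]]; last first.
  rewrite negb_exists => /forallP H; rewrite /f big1// => k _.
  have := H k; rewrite negb_forall => /existsP[j]; rewrite negbK => /eqP kj.
  by rewrite (bigD1 j)//= kj mul0r.
have Xk : `|X (tnth w k)| = 1.
  by have := Hk k; rewrite /h eqxx pnatr_eq0 eqb0 negbK => /eqP.
have Xj j : j != k -> X (tnth w j) = 0.
  by move=> /negPf jk; have := Hk j; rewrite /h jk pnatr_eq0 eqb0 negbK => /eqP.
rewrite indicE mem_set/=; last first.
  rewrite lte_fin /S /opA (bigD1 k)//= big1 ?addr0; last by move=> j /Xj.
  by rewrite [X in `|X|](_ : _ = X (tnth w k))// Xk.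
rewrite /f (bigD1 k)//= [X in _ + X]big1 => [|l lk]; last first.
  rewrite (bigD1 k)//= /h eq_sym (negPf lk).
  by rewrite (_ : (_ == 0) = false) ?mul0r// -normr_eq0 Xk oner_eq0.
rewrite addr0; apply: prodr_ile1 => j _; rewrite h0/= /h.
by case: ifP => _; rewrite lern1 leq_b1.
Qed.

End signed_indicator_sum.

(** * Upper limits at zero *)

Section limsup_at_zero.
Context {R : realType}.
Implicit Types (g : R -> R) (c : R).

Lemma limsup0_le g c : (exists2 delta, 0 < delta &
    forall x, 0 < x < delta -> g x <= c) -> (limsup0 g <= c%:E)%E.
Proof.
move=> [delta d0 gc]; pose I : set R := `]0, delta[%classic.
apply: (@le_trans _ _ (ereal_sup ((EFin \o g) @` I))).
  apply: ereal_inf_lbound; exists `]0, delta[%classic => //.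
  exists delta => //= x /=; rewrite sub0r normrN => xd x0.
  by rewrite in_itv/= x0 (le_lt_trans (ler_norm x)).
apply: ge_ereal_sup => _ [x /= xd <-]; rewrite lee_fin gc//.
Qed.

Lemma limsup0_lt g c : (limsup0 g < c%:E)%E ->
  exists r delta, [/\ r < c, 0 < delta & forall x, 0 < x < delta -> g x <= r].
Proof.
move=> /ereal_inf_lt[_ [A A0 <-]] Ac.
have [delta d0 dA] : exists2 delta, 0 < delta & forall x, 0 < x < delta -> A x.
  move: A0 => [e /= e0 eA]; exists e => // x /andP[x0 xe]; apply: eA => //=.
  by rewrite sub0r normrN gtr0_norm.
have gA x : 0 < x < delta -> ((g x)%:E <= ereal_sup ((EFin \o g) @` A))%E.
  by move=> xd; apply: ereal_sup_ubound; exists x => //; exact: dA.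
move: Ac gA; case: (ereal_sup _) => [r|//|] Ac gA.
  by exists r, delta; split => // x /gA; rewrite lee_fin.
have := gA (delta / 2); rewrite divr_gt0//= ltr_pdivrMr// ltr_pMr// ltr1n.
by move=> /(_ isT); rewrite leeNy_eq.
Qed.

Lemma limsup0_gt g c : (c%:E < limsup0 g)%E ->
  forall delta, 0 < delta -> exists2 x, 0 < x < delta & c < g x.
Proof.
move=> cg delta d0; apply/not_exists2P => H.
move: cg; rewrite ltNge => /negP; apply; apply: limsup0_le; exists delta => // x xd.
by have [//|/negP] := H x; rewrite -leNgt.
Qed.

End limsup_at_zero.

(** * Growth and decay of psi *)

Section psi_growth.
Context {R : realType} (psi : Psi R).
Implicit Types (a b c t u x y : R).

Lemma powR_ge1 x a : 1 <= x -> 0 <= a -> 1 <= x `^ a.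
Proof. by move=> x1 a0; rewrite -[leLHS](powRr0 x) ler_powR. Qed.

Lemma le_exp_nat (k : nat) x : (1 < k)%N -> exists i : nat, x <= k%:R ^+ i.
Proof.
move=> k1; exists (Num.truncn x).+1.
by rewrite -natrX (le_trans (ltW (truncnS_gt x)))// ler_nat ltnW// ltn_expl.
Qed.

Lemma psi_le_mul c x y : 1 <= c -> 0 <= x <= 1 -> 0 <= y <= 1 -> y <= c * x ->
  psi y <= c * psi x.
Proof.
move=> c1 x01 y01 ycx; have [x0 x1] := andP x01; have [y0 y1] := andP y01.
have psix := psi_ge0 psi x01.
have [yx|xy] := leP y x.
  by apply: (le_trans (le_psi psi y0 yx x1)); rewrite ler_peMl.
have yp : 0 < y by exact: le_lt_trans x0 xy.
have xy01 : 0 <= x / y <= 1 by rewrite divr_ge0//= ler_pdivrMr// mul1r ltW.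
have := psi_scale psi xy01 y01; rewrite divfK ?gt_eqF// => H.
have c0 : 0 < c by lra.
apply: (le_trans _ (ler_wpM2l (ltW c0) H)); rewrite mulrA -[leLHS]mul1r.
by rewrite ler_wpM2r ?psi_ge0// mulrA ler_pdivlMr// mul1r.
Qed.

(** Induction on the least i with t <= k^i: the hypothesis multiplies u by k at the
cost of k^a as long as u < delta; once u >= delta, psi u is comparable to psi 1. *)
Lemma psi_growth (k : nat) (a delta : R) : (1 < k)%N -> 0 <= a -> 0 < delta ->
    (forall u, 0 < u < delta -> psi (k%:R * u) <= k%:R `^ a * psi u) ->
  exists2 C, 1 <= C & forall u t, 0 < u -> 1 <= t -> t * u <= 1 ->
    psi (t * u) <= C * t `^ a * psi u.
Proof.
move=> k1 a0 d0' H.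
(* Below d the dilation by k stays inside [0, 1]. *)
pose d := Num.min delta (k%:R^-1).
have k1R : 1 < k%:R :> R by rewrite ltr1n.
have kp : 0 < k%:R :> R by lra.
have d0 : 0 < d by rewrite lt_min d0' invr_gt0.
have d1 : d <= 1 by rewrite ge_min invf_le1// (ltW k1R) orbT.
have dk : d <= k%:R^-1 by rewrite ge_min lexx orbT.
have pd : 0 < psi d by exact: psi_gt0.
pose C := Num.max (psi 1 / psi d) (k%:R `^ a).
have ka1 : 1 <= k%:R `^ a by rewrite powR_ge1// ltW.
have C1 : 1 <= C by rewrite le_max ka1 orbT.
exists C => // u t u0 t1 tu1.
have [i ti] := le_exp_nat t k1.
elim: i => [|i IH] in u t u0 t1 tu1 ti *.
  have -> : t = 1 by apply/le_anti; rewrite t1 -(expr0 k%:R) ti.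
  rewrite mul1r powR1 mulr1 ler_peMl// psi_ge0// ltW//=.
  by rewrite (le_trans _ tu1)// ler_peMl// ltW.
have t0 : 0 < t by lra.
have ta1 : 1 <= t `^ a by exact: powR_ge1.
have ut : u <= t * u by rewrite ler_peMl// ltW.
have u1 : u <= 1 := le_trans ut tu1.
have pu0 : 0 <= psi u by rewrite psi_ge0// (ltW u0).
have [du|ud] := leP d u.
  apply: (@le_trans _ _ (psi 1)); first by rewrite le_psi// mulr_ge0// ltW.
  apply: (@le_trans _ _ (C * psi u)).
    apply: (@le_trans _ _ (psi 1 / psi d * psi u)); last first.
      by rewrite ler_wpM2r// le_max lexx.
    rewrite -mulrA ler_peMr ?psi_ge0 ?lexx ?ler01//.
    by rewrite ler_pdivlMl// mulr1 le_psi// ltW.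
  by rewrite ler_wpM2r// ler_peMr// (le_trans ler01 C1).
have ku1 : k%:R * u <= 1.
  by rewrite mulrC -ler_pdivlMr// mul1r (le_trans (ltW ud)).
have udl : 0 < u < delta by rewrite u0 (lt_le_trans ud)// ge_min lexx.
have [tk|kt] := leP t k%:R.
  apply: (@le_trans _ _ (psi (k%:R * u))).
    by rewrite le_psi// ?mulr_ge0 ?ler_wpM2r// ltW.
  apply: (le_trans (H u udl)); rewrite ler_wpM2r//.
  apply: (@le_trans _ _ C); first by rewrite le_max lexx orbT.
  by rewrite ler_peMr// (le_trans ler01 C1).
have -> : t * u = t / k%:R * (k%:R * u) by field; rewrite gt_eqF.
have tk1 : 1 <= t / k%:R by rewrite ler_pdivlMr// mul1r ltW.
have := IH (k%:R * u) (t / k%:R) (mulr_gt0 kp u0) tk1.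
have -> : t / k%:R * (k%:R * u) = t * u by field; rewrite gt_eqF.
move=> /(_ tu1); rewrite ler_pdivrMr// -exprSr => /(_ ti) H1.
apply: (le_trans H1); apply: (@le_trans _ _ (C * (t / k%:R) `^ a * (k%:R `^ a * psi u))).
  by rewrite ler_wpM2l ?H// mulr_ge0 ?powR_ge0// (le_trans ler01 C1).
rewrite mulrA -(mulrA C) -powRM ?divr_ge0 ?(ltW t0) ?(ltW kp)//.
by rewrite divfK ?gt_eqF.
Qed.

(** Induction on the least i with m <= l^i, replacing u by u^l and m by m / l; the
factor l^g pays for the last, incomplete step. *)
Lemma psi_decay (l : nat) (g delta : R) : (1 < l)%N -> 0 <= g -> delta <= 1 ->
    (forall u, 0 < u < delta -> psi (u ^+ l) <= l%:R `^ (- g) * psi u) ->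
  forall u m, 0 < u < delta -> 1 <= m ->
    psi (u `^ m) <= l%:R `^ g * m `^ (- g) * psi u.
Proof.
move=> l1 g0 d1 H u m ud m1.
have l1R : 1 < l%:R :> R by rewrite ltr1n.
have lp : 0 < l%:R :> R by lra.
have [i mi] := le_exp_nat m l1.
have small v p : 0 < v < delta -> 1 <= p -> p <= l%:R ->
    psi (v `^ p) <= l%:R `^ g * p `^ (- g) * psi v.
  move=> /andP[v0 vd] p1 pl; have v1 : v < 1 by lra.
  have p0 : 0 < p by lra.
  apply: (@le_trans _ _ (psi v)).
    rewrite le_psi ?powR_ge0 ?(ltW v1)//.
    by rewrite -[leRHS]powRr1 ?(ltW v0)// ger_powR// (ltW v1) v0.
  rewrite ler_peMl ?psi_ge0 ?(ltW v0) ?(ltW v1)//.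
  rewrite powRN ler_pdivlMr ?powR_gt0// mul1r.
  by rewrite ge0_ler_powR// nnegrE ltW.
elim: i => [|i IH] in u m ud m1 mi *.
  by apply: small => //; rewrite (le_trans mi)// expr0 ltW.
have /andP[u0 ul] := ud.
have m0 : 0 < m by lra.
have u1 : u < 1 by lra.
have pu0 : 0 <= psi u by rewrite psi_ge0// (ltW u0) (ltW u1).
have [ml|lm] := leP m l%:R; first exact: small.
have ulp : 0 < u ^+ l < delta.
  rewrite exprn_gt0//= (le_lt_trans _ ul)// -[leRHS]expr1.
  by rewrite ler_wiXn2l ?(ltW u0) ?(ltW u1)// ltnW.
have ml1 : 1 <= m / l%:R by rewrite ler_pdivlMr// mul1r ltW.
have := IH (u ^+ l) (m / l%:R) ulp ml1; rewrite ler_pdivrMr// -exprSr => /(_ mi).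
rewrite -powR_mulrn ?(ltW u0)// -powRrM mulrC divfK ?gt_eqF// => H1.
apply: (le_trans H1); rewrite powR_mulrn ?(ltW u0)//.
apply: (@le_trans _ _ (l%:R `^ g * (m / l%:R) `^ (- g) * (l%:R `^ (- g) * psi u))).
  by rewrite ler_wpM2l ?H// mulr_ge0 ?powR_ge0.
rewrite mulrA -(mulrA (l%:R `^ g)) -powRM ?divr_ge0 ?(ltW m0) ?(ltW lp)//.
by rewrite divfK ?gt_eqF.
Qed.

End psi_growth.

Section exponents.
Context {R : realType}.
Implicit Types (c k : R).

Lemma exponent_lt1 c k : 1 < k -> c < k ->
  exists a, [/\ 2^-1 <= a, a < 1 & c <= k `^ a].
Proof.
move=> k1 ck; have lnk : 0 < ln k by rewrite ln_gt0.
have k0 : 0 < k by lra.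
have [c0|c0] := leP c 0.
  by exists 2^-1; split; [|lra|rewrite (le_trans c0)// powR_ge0].
exists (Num.max 2^-1 (ln c / ln k)); split.
- by rewrite le_max lexx.
- by rewrite gt_max ltr_pdivrMr// mul1r ltr_ln ?posrE// ck andbT; lra.
- rewrite -[leLHS]lnK ?posrE// /powR gt_eqF// ler_expR -ler_pdivrMr//.
  by rewrite le_max lexx orbT.
Qed.

Lemma exponent_gt0 c k : 1 < k -> c < 1 -> exists2 g, 0 < g & c <= k `^ (- g).
Proof.
move=> k1 c1; have lnk : 0 < ln k by rewrite ln_gt0.
have k0 : 0 < k by lra.
pose c' := Num.max c 2^-1.
have c'0 : 0 < c' by rewrite lt_max invr_gt0 ltr0n orbT.
have c'1 : c' < 1 by rewrite gt_max c1/=; lra.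
exists (- ln c' / ln k).
  by rewrite divr_gt0// oppr_gt0 ln_lt0// c'0.
apply: (@le_trans _ _ c'); first by rewrite le_max lexx.
rewrite -[leLHS]lnK ?posrE// /powR gt_eqF// ler_expR.
by rewrite le_eqVlt; apply/orP; left; apply/eqP; field; rewrite gt_eqF.
Qed.

End exponents.

(** * Upper estimate of the operator norm *)

Section tail_splitting.
Local Open Scope ereal_scope.
Context {R : realType} (psi : Psi R) d (T : measurableType d).
Context (P : probability T R).
Notation leb := (@lebesgue_measure R).

(** The integrand is nonincreasing and vanishes beyond N. *)
Lemma tail_integral_le_split (x : T -> \bar R) (N t : R) :
    measurable_fun setT x -> (0 <= N)%R -> (0 <= t)%R ->
    (forall s, (N <= s)%R -> tail P x s = 0%R) ->
  tail_integral psi P x <= (t * psi (tail P x 0) + N * psi (tail P x t))%:E.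
Proof.
move=> mx N0 t0 HN.
have p0 := psi_tail_ge0 psi P mx.
have pni := psi_tail_nonincreasing psi P mx.
have lebE c : (0 <= c)%R -> leb `[0%R, c]%classic = c%:E.
  move=> c0; rewrite lebesgue_measure_itv/= lte_fin.
  by move: c0; rewrite le_eqVlt => /predU1P[<-|->]; rewrite ?ltxx// -EFinB subr0.
have mI c : measurable (`[0%R, c]%classic : set R) by [].
have -> : (t * psi (tail P x 0) + N * psi (tail P x t))%:E =
    \int[leb]_s ((psi (tail P x 0))%:E * (\1_(`[0%R, t]%classic) s)%:E +
                 (psi (tail P x t))%:E * (\1_(`[0%R, N]%classic) s)%:E).
  rewrite ge0_integral_indicD//.
  rewrite [X in _ = _ * X + _](lebE t t0) [X in _ = _ + _ * X](lebE N N0).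
  by rewrite -!EFinM -EFinD mulrC (mulrC N).
rewrite /tail_integral integral_mkcond; apply: ge0_le_integral => //.
- by move=> s _; apply: erestrict_ge0 => {}s _; rewrite lee_fin.
- apply/(measurable_restrictT _ (measurable_itv `[0%R, +oo[)).
  apply: (@measurable_funTS _ _ _ _ _ (EFin \o (psi \o tail P x))).
  by apply/measurable_EFinP; exact: nonincreasing_measurable.
- apply: emeasurable_funD; apply/measurable_funeM/measurable_EFinP;
    exact: measurable_indic.
move=> s _; rewrite patchE mem_setE in_itv/= andbT; case: ifPn => s0; last first.
  by rewrite adde_ge0// mule_ge0// lee_fin.
rewrite -!EFinM -EFinD lee_fin !indicE !mem_setE !in_itv/= s0/=.
have [st|ts] := leP s t.
  by rewrite mulr1 ler_wpDr ?mulr_ge0//; exact: pni.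
rewrite mulr0 add0r; have [sN|Ns] := leP s N.
  by rewrite mulr1; apply: pni; exact: ltW.
by rewrite (HN s (ltW Ns)) psi0 mulr0.
Qed.

End tail_splitting.

Section exponential_tails.
Context {R : realType}.
Implicit Types (l s w M : R).

(** From exp x <= 1 / (1 - x) at l and - l, the mean of the two bounds being
1 / (1 - l^2). *)
Lemma cosh_sub1_le l : 0 <= l <= 2^-1 -> (expR l + expR (- l)) / 2 - 1 <= 2 * l ^+ 2.
Proof.
move=> /andP[l0 l2].
have E (x : R) : x < 1 -> expR x <= (1 - x)^-1.
  move=> x1; rewrite -[leLHS]invrK -expRN lef_pV2 ?posrE ?expR_gt0 ?subr_gt0//.
  exact: expR_ge1Dx.
have H1 := E l ltac:(lra); have H2 := E (- l) ltac:(lra).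
have ll : l ^+ 2 <= 2^-1 * 2^-1 by rewrite expr2 ler_pM.
have D0 : 0 < 1 - l ^+ 2 by lra.
have : (expR l + expR (- l)) / 2 <= (1 - l ^+ 2)^-1.
  have -> : (1 - l ^+ 2)^-1 = ((1 - l)^-1 + (1 - - l)^-1) / 2.
    by field; rewrite !gt_eqF//; lra.
  by rewrite ler_wpM2r ?invr_ge0//; lra.
suff : (1 - l ^+ 2)^-1 <= 1 + 2 * l ^+ 2 by lra.
rewrite -[leLHS]mul1r ler_pdivrMr//.
have -> : (1 + 2 * l ^+ 2) * (1 - l ^+ 2) = 1 + l ^+ 2 * (1 - 2 * l ^+ 2) by ring.
by rewrite lerDl mulr_ge0 ?sqr_ge0//; lra.
Qed.

Variables (w : R) (p : R -> R).
Hypothesis pexp : forall l s, 0 <= l ->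
  p s <= 2 * expR (w * ((expR l + expR (- l)) / 2 - 1) - l * s).

(** Take l = - ln w. *)
Lemma exponential_tail_small s : 0 < w <= 1 -> p s <= 2 * expR 1 * w `^ s.
Proof.
move=> /andP[w0 w1]; have l0 : 0 <= - ln w by rewrite oppr_ge0 ln_le0.
apply: (le_trans (pexp s l0)); rewrite -mulrA ler_wpM2l//.
rewrite /powR gt_eqF// -expRD ler_expR opprK mulNr opprK mulrC (mulrC s).
rewrite lerD2r expRN lnK ?posrE//.
have -> : ((w^-1 + w) / 2 - 1) * w = (1 + w * w) / 2 - w by field; rewrite gt_eqF.
have : w * w <= 1 * 1 by rewrite ler_pM// ltW.
lra.
Qed.

(** Take l = 1 / (2 M). *)
Lemma exponential_tail_large M s : 1 <= M -> 0 <= w <= M ^+ 2 ->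
  p s <= 2 * expR 1 * expR (- (s / (2 * M))).
Proof.
move=> M1 /andP[w0 wM]; have M0 : 0 < M by lra.
have l0 : 0 <= (2 * M)^-1 by rewrite invr_ge0 mulr_ge0// ltW.
have l2 : (2 * M)^-1 <= 2^-1 by rewrite lef_pV2 ?posrE ?mulr_gt0//; lra.
apply: (le_trans (pexp s l0)); rewrite -mulrA ler_wpM2l//.
rewrite -expRD ler_expR (mulrC s) lerD2r.
have l02 : 0 <= (2 * M)^-1 <= 2^-1 by rewrite l0.
apply: (le_trans (ler_wpM2l w0 (cosh_sub1_le l02))).
have -> : w * (2 * (2 * M)^-1 ^+ 2) = w / (M ^+ 2) / 2 by field; rewrite gt_eqF.
have : w / M ^+ 2 <= 1 by rewrite ler_pdivrMr ?exprn_gt0// mul1r.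
lra.
Qed.

End exponential_tails.

Section split_bound.
Context {R : realType} (psi : Psi R) (a g C1 D delta : R).
Let d : R := (1 - a) / 2.

Let M (w : R) : R := Num.max 1 (w `^ 2^-1).

Let M1 w : 1 <= M w. Proof. by rewrite le_max lexx. Qed.

Let M_le1 w : 0 < w <= 1 -> M w = 1.
Proof. by move=> w01; rewrite /M max_l// -[leRHS](powRr0 w) ger_powR. Qed.

Let M2 w : 0 <= w -> w <= M w ^+ 2.
Proof.
move=> w0; have wM : w `^ 2^-1 <= M w by rewrite le_max lexx orbT.
have {1}<- : (w `^ 2^-1) ^+ 2 = w.
  by rewrite -powR_mulrn ?powR_ge0// -powRrM mulVf// powRr1.
by rewrite lerXn2r ?nnegrE ?powR_ge0// (le_trans ler01).
Qed.

(** If n u <= 1, dilate u by n.  If not, dilate u by 1 / u to reach 1; since a is at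
least 1/2, the factor sqrt(n u) is at most (n u)^a. *)
Lemma head_bound (n u p0 : R) : 2^-1 <= a -> 1 <= C1 ->
    (forall u t : R, 0 < u -> 1 <= t -> t * u <= 1 ->
      psi (t * u) <= C1 * t `^ a * psi u) ->
    1 <= n -> 0 < u <= 1 -> 0 <= p0 <= 1 -> p0 <= n * u ->
  M (n * u) * psi p0 <= C1 * n `^ a * psi u.
Proof.
move=> a2 C11 growth n1 /andP[u0 u1] p01 pnu; have [p00 p01'] := andP p01.
have n0 : 0 < n by lra.
have nu0 : 0 < n * u by rewrite mulr_gt0.
have [nu1|nu1] := leP (n * u) 1.
  rewrite M_le1 ?nu0// mul1r.
  by apply: le_trans (growth u n u0 n1 nu1); exact: le_psi.
have Mnu : M (n * u) <= (n * u) `^ a.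
  have nu1' := ltW nu1.
  by rewrite ge_max powR_ge1 ?ler_powR//; lra.
have pu : psi p0 <= C1 * u^-1 `^ a * psi u.
  have := growth u u^-1 u0 _ _; rewrite mulVf ?gt_eqF// lexx invf_ge1// => /(_ u1 isT).
  by apply: le_trans; exact: le_psi.
apply: (le_trans (ler_pM _ (psi_ge0 psi p01) Mnu pu)).
  by rewrite (le_trans ler01).
rewrite !mulrA ler_wpM2r//; first by rewrite psi_ge0// u1 ltW.
rewrite (mulrC _ C1) -!mulrA ler_wpM2l ?(le_trans ler01)//.
by rewrite -powRM ?invr_ge0 ?(ltW nu0) ?(ltW u0)// mulfK ?gt_eqF.
Qed.

(** The exponential tails turn p (T) into a power v^m with m = (d / 8) n^(d / 2) and
v at most u, to which the decay of psi applies. *)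
Lemma tail_bound (n u : R) (p : R -> R) : 2^-1 <= a -> a < 1 -> 0 < D ->
    (forall u m : R, 0 < u < delta -> 1 <= m ->
      psi (u `^ m) <= D * m `^ (- g) * psi u) ->
    1 <= n -> n^-1 < delta -> 8 / d <= n `^ (d / 2) -> 0 < u <= 1 ->
    (forall s, 0 <= p s <= 1) ->
    (forall l s, 0 <= l ->
      p s <= 2 * expR (n * u * ((expR l + expR (- l)) / 2 - 1) - l * s)) ->
  psi (p (n `^ d * M (n * u))) <=
    2 * expR 1 * (D * (d / 8) `^ (- g)) * n `^ (- (d / 2 * g)) * psi u.
Proof.
move=> a2 a1 D0 decay n1 ndelta nd /andP[u0 u1] p01 pexp.
have d0 : 0 < d by rewrite /d; lra.
have d1 : d <= 1 by rewrite /d; lra.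
have n0 : 0 < n by lra.
have nu0 : 0 < n * u by rewrite mulr_gt0.
(* n^d = b^2, while ln n is at most (2 / d) * b. *)
set b := n `^ (d / 2) in nd *.
have b0 : 0 < b by rewrite powR_gt0.
have nb : n `^ d = b * b.
  by rewrite /b -powRD ?gt_eqF ?implybT// -splitr.
pose m := d / 8 * b.
have m1 : 1 <= m.
  have d8 : 0 < d / 8 by lra.
  by rewrite /m mulrC -ler_pdivrMr// div1r invf_div.
have b1 : 1 <= b by rewrite powR_ge1//; lra.
have mb : m <= b * b / 2.
  have : m <= 1 * b by rewrite /m ler_wpM2r ?(ltW b0)//; lra.
  have : 2 * m <= b * 1 by rewrite /m; nra.
  by rewrite ler_pdivlMr//; nra.
have mg : m `^ (- g) = (d / 8) `^ (- g) * n `^ (- (d / 2 * g)).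
  rewrite /m powRM ?(ltW b0)//; last by rewrite divr_ge0// ltW.
  by rewrite /b -powRrM; congr (_ * _ `^ _); ring.
have K1 : 1 <= 2 * expR 1 :> R.
  by have := @expR_ge1Dx R 1; lra.
suff [v [v0 vu vd pv]] : exists v, [/\ 0 < v, v <= u, v < delta &
    p (b * b * M (n * u)) <= 2 * expR 1 * v `^ m].
  have v1 : v <= 1 by lra.
  have vm1 : 0 <= v `^ m <= 1.
    by rewrite powR_ge0/= -[leRHS](powRr0 v) ger_powR ?v0// (le_trans ler01).
  rewrite nb; apply: (le_trans (psi_le_mul psi K1 vm1 (p01 _) pv)).
  rewrite -!(mulrA (2 * expR 1)) ler_wpM2l ?(le_trans ler01)//.
  have vdd : 0 < v < delta by rewrite v0.
  apply: (le_trans (decay v m vdd m1)); rewrite mg !mulrA.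
  rewrite ler_wpM2l ?le_psi ?(ltW v0)//.
  by rewrite !mulr_ge0 ?powR_ge0// ltW.
(* If u is at most n^-2, then n u is at most the square root of u, and the
   tail is at most a power of u itself.  If not, the stretched exponential
   bound is compared with a power of n^-2, which lies below u. *)
have [small|large] := leP (n * (n * u)) 1.
  have nu1 : n * u <= 1 by nra.
  exists u; split => //.
    apply: le_lt_trans ndelta; rewrite -[leRHS]mul1r ler_pdivlMr// mulrC.
    exact: nu1.
  have M1E : M (n * u) = 1 by rewrite M_le1 ?nu0.
  have nu01 : 0 < n * u <= 1 by rewrite nu0.
  rewrite M1E mulr1; apply: (le_trans (exponential_tail_small pexp _ nu01)).
  rewrite ler_wpM2l ?(le_trans ler01)//.
  have nuu : n * u <= u `^ 2^-1.
    have nuE : n * u = ((n * u) ^+ 2) `^ 2^-1.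
      by rewrite -powR_mulrn ?(ltW nu0)// -powRrM divff ?pnatr_eq0// powRr1 ?(ltW nu0).
    rewrite [leLHS]nuE ge0_ler_powR ?nnegrE ?exprn_ge0 ?(ltW nu0) ?(ltW u0)//.
    have -> : (n * u) ^+ 2 = n * (n * u) * u by ring.
    by rewrite -[leRHS]mul1r ler_wpM2r// ltW.
  apply: (@le_trans _ _ ((u `^ 2^-1) `^ (b * b))).
    by rewrite ge0_ler_powR ?nnegrE ?powR_ge0 ?mulr_ge0 ?(ltW nu0)// ltW.
  rewrite -powRrM ger_powR ?u0//; lra.
exists (n^-1 * n^-1); split.
- by rewrite mulr_gt0 ?invr_gt0.
- rewrite -invfM -[leLHS]mul1r ler_pdivrMr ?mulr_gt0// ltW//.
  by have -> : u * (n * n) = n * (n * u) by ring.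
- apply: le_lt_trans ndelta; rewrite -[leRHS]mul1r ler_wpM2r ?invr_ge0 ?(ltW n0)//.
  by rewrite invf_le1.
have nuM : 0 <= n * u <= M (n * u) ^+ 2 by rewrite (ltW nu0)/= M2// ltW.
apply: (le_trans (exponential_tail_large pexp _ (M1 _) nuM)).
rewrite ler_wpM2l ?(le_trans ler01)//.
have -> : (n^-1 * n^-1) `^ m = expR (- (2 * m * ln n)).
  rewrite /powR gt_eqF ?mulr_gt0 ?invr_gt0// -invfM lnV ?posrE ?mulr_gt0//.
  by rewrite lnM ?posrE//; congr expR; ring.
have M0 : 0 < M (n * u) by rewrite (lt_le_trans ltr01).
have -> : b * b * M (n * u) / (2 * M (n * u)) = b * b / 2 by field; rewrite gt_eqF.
rewrite ler_expR lerN2.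
have lnb : ln b <= b.
  by have := @le_ln1Dx R (b - 1); rewrite subrKC; lra.
have -> : ln n = 2 / d * ln b by rewrite /b ln_powR; field; rewrite gt_eqF.
have -> : 2 * m * (2 / d * ln b) = b * ln b / 2 by rewrite /m; field; rewrite gt_eqF.
by rewrite ler_wpM2r// ler_wpM2l// ltW.
Qed.

End split_bound.

Section upper_estimate.
Context {R : realType} (psi : Psi R) (r : R -> R).
Hypothesis hr : centered_bernoulli r.

Lemma opnorm_le (n : nat) (K : R) : 0 <= K ->
    (forall e : R -> R, measurable_fun setT e ->
      (forall x, `|e x| = (e x != 0)%:R) ->
      (tail_integral psi (leb01_pow n) (EFin \o opA r e) <=
      (K * psi (fine (leb01 [set x | e x != 0%R])))%:E)%E) ->
  (opnorm psi r n <= K%:E)%E.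
Proof.
move=> K0 He; have mr := measurable_bernoulli hr.
apply: ge_ereal_sup => _ [f /= [[mf _] f1] <-].
have mf' : measurable_fun setT (EFin \o f) by exact/measurable_EFinP.
rewrite lorentz_norm_onE; last exact: measurable_opA.
apply: (le_trans (tail_integral_opA_le mr K0 He mf)).
rewrite -[leRHS]mule1 lee_wpmul2l ?lee_fin//.
by move: f1; rewrite lorentz_normE.
Qed.

Lemma opnorm_le_powR (a g C1 D delta : R) :
    2^-1 <= a -> a < 1 -> 0 < g -> 1 <= C1 -> 0 < D -> 0 < delta ->
    (forall u t : R, 0 < u -> 1 <= t -> t * u <= 1 ->
      psi (t * u) <= C1 * t `^ a * psi u) ->
    (forall u m : R, 0 < u < delta -> 1 <= m ->
      psi (u `^ m) <= D * m `^ (- g) * psi u) ->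
  exists q C : R, [/\ 2^-1 <= q, q < 1, 0 < C &
    forall n : nat, (1 <= n)%N -> (opnorm psi r n <= (C * n%:R `^ q)%:E)%E].
Proof.
move=> a2 a1 g0 C11 D0 delta0 growth decay.
pose d := (1 - a) / 2.
have d0 : 0 < d by rewrite /d; lra.
pose q := Num.max (a + d) (1 - d / 2 * g).
(* Below X0 the trivial bound 2 n^2 on the norm is absorbed by the constant;
   above X0 both thresholds of the tail estimate are met. *)
pose X0 := Num.max (delta^-1 + 1) ((8 / d) `^ (2 / d)).
have [C2 C2E] : exists c, c = 2 * expR 1 * (D * (d / 8) `^ (- g)) by eexists.
have C20 : 0 <= C2 by rewrite C2E !mulr_ge0 ?powR_ge0 ?expR_ge0// ltW.
pose C := 2 * X0 ^+ 2 + (C1 + C2).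
have X01 : 1 <= X0 by rewrite le_max lerDr invr_ge0 ltW.
have C0 : 0 < C.
  have : 0 <= X0 ^+ 2 by exact: sqr_ge0.
  by rewrite /C; lra.
exists q, C; split => //.
- by rewrite le_max (le_trans a2)// lerDl ltW.
- rewrite gt_max; apply/andP; split; first by rewrite /d; lra.
  by rewrite ltrBlDr ltrDl mulr_gt0// divr_gt0.
move=> n n1; have n1R : 1 <= n%:R :> R by rewrite ler1n.
have n0R : 0 < n%:R :> R by lra.
have nq1 : 1 <= n%:R `^ q.
  by rewrite powR_ge1// le_max; apply/orP; left; lra.
apply: opnorm_le => [|e me e01]; first by rewrite mulr_ge0 ?powR_ge0// ltW.
set u := fine (leb01 [set x | e x != 0]).
have u01 : 0 <= u <= 1 := support_itv me.
have mS : measurable_fun setT (EFin \o (opA r e : n.-tuple _ -> R)).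
  by apply/measurable_EFinP; apply: measurable_opA => //; exact: measurable_bernoulli.
set p := tail (leb01_pow n) (EFin \o opA r e).
have p01 s : 0 <= p s <= 1 by exact: tail_itv.
have pun s : 0 <= s -> p s <= n%:R * u by exact: tail_opA_le_union.
have split t : 0 <= t ->
    (tail_integral psi (leb01_pow n) (EFin \o opA r e) <=
     (t * psi (p 0) + n%:R * psi (p t))%:E)%E.
  move=> t0; apply: tail_integral_le_split => //.
  by move=> s; exact: tail_opA_eq0.
have psiu : 0 <= psi u := psi_ge0 psi u01.
have [nX|Xn] := leP n%:R X0.
  apply: (le_trans (split n%:R (ltW n0R))); rewrite lee_fin.
  have pn s : 0 <= s -> psi (p s) <= X0 * psi u.
    move=> s0; apply: psi_le_mul => //; apply: (le_trans (pun s s0)).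
    by rewrite ler_wpM2r//; case/andP: u01.
  apply: (@le_trans _ _ (X0 * (X0 * psi u) + X0 * (X0 * psi u))).
    by rewrite lerD// ler_pM ?psi_ge0 ?pn// ltW.
  have -> : X0 * (X0 * psi u) + X0 * (X0 * psi u) = 2 * X0 ^+ 2 * 1 * psi u by ring.
  rewrite ler_wpM2r// ler_pM//.
    by rewrite mulr_ge0// sqr_ge0.
  by rewrite /C lerDl; lra.
have [u0|] := ltP 0 u; last first.
  move=> u0; have {}u0 : u = 0 by apply/le_anti; rewrite u0; case/andP: u01.
  apply: (le_trans (split 0 (lexx 0))); rewrite lee_fin mul0r add0r u0.
  have -> : p 0 = 0.
    apply/le_anti; have /andP[-> _] := p01 0; rewrite andbT.
    by rewrite (le_trans (pun 0 (lexx 0)))// u0 mulr0.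
  by rewrite psi0 !mulr0.
have u0u1 : 0 < u <= 1 by rewrite u0; case/andP: u01.
pose M := Num.max 1 ((n%:R * u) `^ 2^-1).
have M0 : 0 <= M by rewrite le_max ler01.
have t0 : 0 <= n%:R `^ d * M by rewrite mulr_ge0 ?powR_ge0.
apply: (le_trans (split _ t0)); rewrite lee_fin.
have ndelta : n%:R^-1 < delta.
  rewrite -[ltRHS]invrK ltf_pV2 ?posrE ?invr_gt0//.
  by apply: lt_trans Xn; rewrite lt_max ltrDl ltr01.
have nd : 8 / d <= n%:R `^ (d / 2).
  have -> : 8 / d = ((8 / d) `^ (2 / d)) `^ (d / 2).
    have dd : 2 / d * (d / 2) = 1 by field; rewrite gt_eqF.
    by rewrite -powRrM dd powRr1// divr_ge0// ltW.
  have X0n : (8 / d) `^ (2 / d) <= n%:R.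
    by apply: le_trans (ltW Xn); rewrite le_max lexx orbT.
  have dh : 0 <= d / 2 by lra.
  by apply: ge0_ler_powR; rewrite ?nnegrE ?powR_ge0 ?(ltW n0R).
have H1 := head_bound a2 C11 growth n1R u0u1 (p01 0) (pun 0 (lexx 0)).
have H2 : psi (p (n%:R `^ d * M)) <= C2 * n%:R `^ (- (d / 2 * g)) * psi u.
  rewrite C2E; exact: (tail_bound a2 a1 D0 decay n1R ndelta nd u0u1 p01
    (fun l s l0 => tail_opA_exp n hr me e01 s l0)).
have nD x y : n%:R `^ x * n%:R `^ y = n%:R `^ (x + y) :> R.
  by rewrite powRD// (gt_eqF n0R) implybT.
have q1 : n%:R `^ (a + d) <= n%:R `^ q by rewrite ler_powR// le_max lexx.
have q2 : n%:R `^ (1 - d / 2 * g) <= n%:R `^ q by rewrite ler_powR// le_max lexx orbT.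
have E1 : n%:R `^ d * M * psi (p 0) <= C1 * n%:R `^ q * psi u.
  rewrite -mulrA; apply: (le_trans (ler_wpM2l (powR_ge0 _ _) H1)).
  rewrite !mulrA ler_wpM2r// (mulrC _ C1) -mulrA ler_wpM2l ?(le_trans ler01)//.
  by rewrite nD addrC.
have E2 : n%:R * psi (p (n%:R `^ d * M)) <= C2 * n%:R `^ q * psi u.
  apply: (le_trans (ler_wpM2l (ltW n0R) H2)).
  rewrite !mulrA ler_wpM2r// (mulrC _ C2) -(mulrA C2) ler_wpM2l//.
  by rewrite -{1}[n%:R]powRr1 ?(ltW n0R)// nD.
apply: (le_trans (lerD E1 E2)); rewrite -!mulrDl ler_wpM2r//.
by rewrite ler_wpM2r ?powR_ge0// /C lerDr mulr_ge0// sqr_ge0.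
Qed.

End upper_estimate.

(** * Lower estimates of the operator norm *)

Section lower_estimate.
Context {R : realType} (psi : Psi R).
Notation leb := (@lebesgue_measure R).
Notation TR := (measurableTypeR R).

Lemma tail_integral_ge d (T : measurableType d) (P : probability T R)
    (x : T -> \bar R) (b y : R) : measurable_fun setT x -> 0 <= b -> 0 <= y <= 1 ->
    (forall s, s < b -> y <= tail P x s) ->
  ((b * psi y)%:E <= tail_integral psi P x)%E.
Proof.
move=> mx b0 /andP[y0 y1] yP.
have mI : measurable (`[0%R, b[%classic : set R) by [].
have -> : (b * psi y)%:E = (\int[leb]_(s in `[0%R, b[) cst (psi y)%:E s)%E.
  rewrite integral_cst//= lebesgue_measure_itv/= lte_fin.
  move: b0; rewrite le_eqVlt => /predU1P[<-|->]; first by rewrite ltxx mul0r mule0.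
  by rewrite -EFinB subr0 -EFinM mulrC.
rewrite /tail_integral.
have mpsi : measurable_fun setT (EFin \o (psi \o tail P x)).
  apply/measurable_EFinP; apply: nonincreasing_measurable => //.
  exact: psi_tail_nonincreasing.
apply: (@le_trans _ _ (\int[leb]_(s in `[0%R, b[) (psi (tail P x s))%:E)%E).
  apply: ge0_le_integral => //.
  - by move=> s _; rewrite lee_fin psi_ge0// y0.
  - exact: (measurable_funTS mpsi).
  - move=> s /=; rewrite in_itv/= => /andP[_ sb]; rewrite lee_fin le_psi ?yP//.
    by have /andP[] := tail_itv P mx s.
apply: ge0_subset_integral => //.
- exact: (measurable_funTS mpsi).
- by move=> s _; rewrite lee_fin psi_tail_ge0.
- by move=> s /=; rewrite !in_itv/= => /andP[->].
Qed.

Variable r : R -> R.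
Hypothesis hr : centered_bernoulli r.

(** Test the operator on the indicator of [0, u] divided by psi u. *)
Lemma opnorm_ge (n : nat) (u b y : R) : 0 < u <= 1 -> 0 <= b -> 0 <= y <= 1 ->
    (forall e : R -> R, measurable_fun setT e ->
      (forall x, `|e x| = (e x != 0)%:R) -> fine (leb01 [set x | e x != 0]) = u ->
      forall s, s < b -> y <= tail (leb01_pow n) (EFin \o opA r e) s) ->
  ((b * psi y / psi u)%:E <= opnorm psi r n)%E.
Proof.
move=> /andP[u0 u1] b0 y01 He.
have u01 : 0 <= u <= 1 by rewrite ltW.
have pu : 0 < psi u by exact: psi_gt0.
have c0 : 0 < (psi u)^-1 by rewrite invr_gt0.
pose e : R -> R := \1_(`[0, u[%classic).
have me : measurable_fun setT e by apply: measurable_indic.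
have eE x : e x = (0 <= x < u)%R%:R by rewrite /e indicE mem_setE in_itv.
have e01 x : `|e x| = (e x != 0)%:R.
  by rewrite eE; case: (_ && _); rewrite ?normr0 ?eqxx// normr1 oner_eq0.
have le : leb01 [set x | e x != 0] = u%:E.
  rewrite -(leb01_lt u01) /leb01 /mrestr; congr (leb _).
  apply/seteqP; split => x /=; rewrite in_itv/= eE pnatr_eq0 eqb0 negbK.
    by move=> [/andP[x0 xu] ?].
  by move=> [xu /andP[x0 x1]]; rewrite x0 xu.
pose f x := (psi u)^-1 * e x.
have mf : measurable_fun setT f by exact: measurable_funM.
have mf' : measurable_fun setT (EFin \o f) by exact/measurable_EFinP.
have tf s : (psi u)^-1 <= s -> tail leb01 (EFin \o f) s = 0.
  move=> cs; rewrite /tail (_ : [set w | _] = set0) ?measure0//.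
  apply/seteqP; split => // x /=; rewrite lte_fin /f eE.
  case: (_ && _); rewrite ?mulr0 ?mulr1 ?normr0 ?gtr0_norm//.
    by rewrite ltNge cs.
  by rewrite ltNge (le_trans (ltW c0)).
have tf0 : tail leb01 (EFin \o f) 0 = u.
  rewrite /tail (_ : [set w | _] = [set x | e x != 0]) ?le//.
  apply/seteqP; split => x /=; rewrite lte_fin normr_gt0 /f mulf_eq0.
    by rewrite (gt_eqF c0).
  by rewrite (gt_eqF c0).
have fnorm : (lorentz_norm psi (EFin \o f) <= 1)%E.
  rewrite lorentz_normE//.
  have := @tail_integral_le_split _ psi _ TR (leb01 : probability TR R) _
    _ _ mf' (ltW c0) (ltW c0) tf.
  move=> H; apply: (le_trans H).
  by rewrite tf0 tf// psi0 mulr0 addr0 mulVf// gt_eqF.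
apply: (@le_trans _ _ (lorentz_norm_on psi (leb01_pow n) (opA r f))); last first.
  apply: ereal_sup_ubound; exists f => //; split => //; split => //.
  by rewrite (le_lt_trans fnorm)// ltry.
have mA : measurable_fun setT (opA r f : n.-tuple (TR * TR)%type -> R).
  by apply: measurable_opA => //; exact: measurable_bernoulli.
rewrite lorentz_norm_onE// mulrAC; apply: tail_integral_ge => //.
- exact/measurable_EFinP.
- by rewrite divr_ge0// ltW.
- move=> s sb; have -> : tail (leb01_pow n) (EFin \o opA r f) s =
      tail (leb01_pow n) (EFin \o opA r e) (s * psi u).
    rewrite /tail; congr (fine (leb01_pow n _)).
    apply/seteqP; split => w /=; rewrite !lte_fin.
      have -> : opA r f w = (psi u)^-1 * opA r e w.
        by rewrite /opA mulr_sumr; apply: eq_bigr => k _; rewrite /f mulrA.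
      by rewrite normrM (gtr0_norm c0) (mulrC (psi u)^-1) ltr_pdivlMr.
    have -> : opA r f w = (psi u)^-1 * opA r e w.
      by rewrite /opA mulr_sumr; apply: eq_bigr => k _; rewrite /f mulrA.
    by rewrite normrM (gtr0_norm c0) (mulrC (psi u)^-1) ltr_pdivlMr.
  apply: He => //; first by rewrite le.
  by rewrite -ltr_pdivlMr.
Qed.

Lemma opnorm_ge_dilation (n : nat) (u : R) : 0 < u -> n%:R * u <= 4^-1 -> (0 < n)%N ->
  ((3 / 4 * (psi (n%:R * u) / psi u))%:E <= opnorm psi r n)%E.
Proof.
move=> u0 nu n0; have n1 : 1 <= n%:R :> R by rewrite ler1n.
have u1 : u <= 1 by nra.
have u01 : 0 < u <= 1 by rewrite u0.
have nu01 : 0 <= n%:R * u <= 1 by rewrite mulr_ge0 ?(ltW u0)//=; lra.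
pose c := (1 - u) ^+ n.-1.
have c1 : c <= 1 by rewrite exprn_ile1//; lra.
have c34 : 3 / 4 <= c.
  suff : 1 - n.-1%:R * u <= c.
    have : n.-1%:R * u <= n%:R * u by rewrite ler_wpM2r ?(ltW u0)// ler_nat leq_pred.
    lra.
  rewrite /c; elim: n.-1 => [|m IH]; first by rewrite expr0; lra.
  rewrite exprS -natr1.
  have : (1 - u) * (1 - m%:R * u) <= (1 - u) * (1 - u) ^+ m by rewrite ler_wpM2l//; lra.
  have : 0 <= m%:R * u * u by rewrite !mulr_ge0// ltW.
  lra.
have c01 : 0 <= c <= 1 by rewrite c1 andbT; lra.
have y01 : 0 <= n%:R * u * c <= 1.
  by have /andP[? ?] := nu01; have /andP[? ?] := c01; rewrite mulr_ge0//= mulr_ile1.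
apply: le_trans (opnorm_ge (n := n) u01 (@ler01 R) y01 _); last first.
  by move=> e me e01 le s s1; rewrite /c -le; exact: tail_opA_ge_one.
rewrite lee_fin mul1r mulrA ler_wpM2r ?invr_ge0 ?(ltW (psi_gt0 psi u0 u1))//.
rewrite (mulrC (n%:R * u) c); apply: le_trans (psi_scale psi c01 nu01).
by rewrite ler_wpM2r// psi_ge0.
Qed.

Lemma opnorm_ge_power (n : nat) (u : R) : 0 < u -> u <= 2^-1 ->
  ((n%:R * (psi (u ^+ (2 * n)) / psi u))%:E <= opnorm psi r n)%E.
Proof.
move=> u0 u2; have u1 : u <= 1 by lra.
have u01 : 0 < u <= 1 by rewrite u0.
have y01 : 0 <= (u / 2) ^+ n <= 1.
  by rewrite exprn_ge0 ?exprn_ile1//; lra.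
apply: le_trans (opnorm_ge (n := n) (b := n%:R) u01 _ y01 _) => //; last first.
  by move=> e me e01 le s s1; rewrite -le; exact: tail_opA_ge_all.
rewrite lee_fin mulrA ler_wpM2r ?invr_ge0 ?(ltW (psi_gt0 psi u0 u1))// ler_wpM2l//.
have [y0 y1] := andP y01.
rewrite le_psi ?exprn_ge0 ?(ltW u0)// exprM lerXn2r ?nnegrE ?exprn_ge0 ?(ltW u0)//.
  by lra.
by rewrite expr2 ler_wpM2l// ltW.
Qed.

End lower_estimate.

Lemma powR_lt_linear (R : realType) (q C : R) : q < 1 -> 0 < C ->
  exists2 n, (0 < n)%N & C * n%:R `^ q < n%:R / 2.
Proof.
move=> q1 C0; pose x := (2 * C) `^ (1 - q)^-1.
exists (Num.truncn x).+1 => //; set n : R := _%:R.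
have n0 : 0 < n by rewrite ltr0n.
have : x < n by exact: truncnS_gt.
have q0 : 0 < 1 - q by lra.
move=> xn; have : 2 * C < n `^ (1 - q).
  have -> : 2 * C = x `^ (1 - q).
    by rewrite -powRrM mulVf ?gt_eqF// powRr1// ltW// mulr_gt0.
  by rewrite gt0_ltr_powR ?nnegrE ?powR_ge0// ltW.
move=> H; have -> : n / 2 = n `^ (1 - q) / 2 * n `^ q.
  rewrite mulrAC -powRD ?subrK ?powRr1 ?(ltW n0)//.
  by rewrite (gt_eqF n0) implybT.
by rewrite ltr_pM2r ?powR_gt0//; lra.
Qed.

(** * The dichotomy *)

Section dichotomy.
Context {R : realType} (psi : Psi R) (r : R -> R).
Hypothesis hr : centered_bernoulli r.

(** By concavity the upper limit never exceeds k; when it is smaller, the ratio is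
at most k^a near 0 for some a < 1, and this propagates to all dilations. *)
Lemma limsup_dilation_lt (k : nat) : (1 <= k)%N ->
    limsup0 (fun u => psi (k%:R * u) / psi u) <> k%:R%:E ->
  exists a C, [/\ 2^-1 <= a, a < 1, 1 <= C & forall u t : R,
    0 < u -> 1 <= t -> t * u <= 1 -> psi (t * u) <= C * t `^ a * psi u].
Proof.
move=> k1 kE; have k0 : 0 < k%:R :> R by rewrite ltr0n.
have small u : 0 < u < k%:R^-1 -> [/\ u <= 1, 0 < psi u & k%:R * u <= 1].
  move=> /andP[u0 uk]; have ku : k%:R * u <= 1.
    by rewrite mulrC -ler_pdivlMr// mul1r ltW.
  have u1 : u <= 1.
    by apply: le_trans ku; rewrite ler_peMl ?(ltW u0)// ler1n.
  by split => //; exact: psi_gt0.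
have : (limsup0 (fun u : R => psi (k%:R * u) / psi u)%R < k%:R%:E)%E.
  rewrite lt_neqAle; apply/andP; split; first exact/eqP.
  apply: limsup0_le; exists k%:R^-1; first by rewrite invr_gt0.
  move=> u uk; have [u1 pu ku] := small u uk; have /andP[u0 _] := uk.
  rewrite ler_pdivrMr// psi_le_mul ?ler1n ?(ltW u0) ?u1 ?mulr_ge0 ?ku//.
  exact: ltW.
move=> /limsup0_lt[c [d [ck d0 Hd]]].
pose d' := Num.min d k%:R^-1.
have d'0 : 0 < d' by rewrite lt_min d0 invr_gt0.
have Hd' u : 0 < u < d' -> psi (k%:R * u) <= c * psi u.
  move=> /andP[u0]; rewrite lt_min => /andP[ud uk].
  have [|u1 pu ku] := small u; first by rewrite u0.
  by rewrite -ler_pdivrMr// Hd// u0.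
have k2 : (1 < k)%N.
  rewrite ltn_neqAle k1 andbT; apply/eqP => kE1.
  have u2 : 0 < d' / 2 < d' by rewrite divr_gt0//= ltr_pdivrMr// ltr_pMr// ltr1n.
  have := Hd' _ u2; rewrite -kE1 mul1r.
  have [|_ pu _] := small (d' / 2).
    by case/andP: u2 => -> u2; rewrite (lt_le_trans u2)// ge_min lexx orbT.
  by rewrite ler_pMl// leNgt -[ltRHS]/(1%:R) kE1 ck.
have [a [a2 a1 ca]] := exponent_lt1 (c := c) (k := k%:R) ltac:(by rewrite ltr1n) ck.
have [|u ud|C C1 HC] := @psi_growth R psi k a d' k2 _ d'0.
- by rewrite (le_trans _ a2)// invr_ge0.
- apply: (le_trans (Hd' u ud)); rewrite ler_wpM2r// ltW//.
  have [|//] := small u; case/andP: ud => -> ud.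
  by rewrite (lt_le_trans ud)// ge_min lexx orbT.
by exists a, C.
Qed.

(** By monotonicity the upper limit never exceeds 1; when it is smaller, the ratio is
at most l^(-g) near 0 for some g > 0, and this propagates to all powers. *)
Lemma limsup_power_lt (l : nat) : (1 <= l)%N ->
    limsup0 (fun u => psi (u ^+ l) / psi u) <> 1%:E ->
  exists g D delta, [/\ 0 < g, 0 < D, 0 < delta & forall u m : R,
    0 < u < delta -> 1 <= m -> psi (u `^ m) <= D * m `^ (- g) * psi u].
Proof.
move=> l1 lE.
have : (limsup0 (fun u : R => psi (u ^+ l) / psi u)%R < 1%:E)%E.
  rewrite lt_neqAle; apply/andP; split; first exact/eqP.
  apply: limsup0_le; exists 1 => // u /andP[u0 u1].
  rewrite ler_pdivrMr ?psi_gt0 ?mul1r ?(ltW u1)// le_psi ?exprn_ge0 ?(ltW u0) ?(ltW u1)//.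
  by rewrite -[leRHS]expr1 ler_wiXn2l ?(ltW u0) ?(ltW u1).
move=> /limsup0_lt[c [d [c1 d0 Hd]]].
pose d' := Num.min d 1.
have d'0 : 0 < d' by rewrite lt_min d0 ltr01.
have Hd' u : 0 < u < d' -> psi (u ^+ l) <= c * psi u.
  move=> /andP[u0]; rewrite lt_min => /andP[ud u1].
  by rewrite -ler_pdivrMr ?psi_gt0 ?(ltW u1)// Hd// u0.
have l2 : (1 < l)%N.
  rewrite ltn_neqAle l1 andbT; apply/eqP => lE1.
  have u2 : 0 < d' / 2 < d' by rewrite divr_gt0//= ltr_pdivrMr// ltr_pMr// ltr1n.
  have := Hd' _ u2; rewrite -lE1 expr1 ler_pMl ?leNgt ?c1//.
  case/andP: u2 => u0 u2; rewrite psi_gt0// ltW// (lt_le_trans u2)//.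
  by rewrite ge_min lexx orbT.
have [g g0 cg] := exponent_gt0 (c := c) (k := l%:R) ltac:(by rewrite ltr1n) c1.
have d'1 : d' <= 1 by rewrite ge_min lexx orbT.
exists g, (l%:R `^ g), d'; split => //; first by rewrite powR_gt0 ?ltr0n.
apply: psi_decay => //; first exact: ltW.
move=> u ud; apply: (le_trans (Hd' u ud)); rewrite ler_wpM2r//.
by case/andP: ud => u0 ud; rewrite psi_ge0// (ltW u0) (le_trans (ltW ud)).
Qed.

Lemma opnorm_not_powR (q C : R) : q < 1 -> 0 < C ->
    (forall n : nat, (1 <= n)%N -> (opnorm psi r n <= (C * n%:R `^ q)%:E)%E) ->
  ~ ((forall k : nat, (1 <= k)%N ->
       limsup0 (fun u => psi (k%:R * u) / psi u) = k%:R%:E) \/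
     (forall l : nat, (1 <= l)%N ->
       limsup0 (fun u => psi (u ^+ l) / psi u) = 1%:E)).
Proof.
move=> q1 C0 Hop; have [n n0 nC] := powR_lt_linear q1 C0.
have nR : 0 < n%:R :> R by rewrite ltr0n.
have Hn (x : R) : (x%:E <= opnorm psi r n)%E -> x < n%:R / 2.
  move=> xn; rewrite -lte_fin; apply: (le_lt_trans xn).
  by apply: (le_lt_trans (Hop n n0)); rewrite lte_fin.
case=> [Hk|Hl].
(* The norm is at least (3/4)^2 n > n / 2. *)
- have : (((3 / 4) * n%:R : R)%:E < limsup0 (fun u : R => psi (n%:R * u) / psi u)%R)%E.
    by rewrite Hk// lte_fin; lra.
  move=> /limsup0_gt/(_ (4^-1 / n%:R)); rewrite divr_gt0// => /(_ isT)[u /andP[u0 un] Hu].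
  have nu4 : n%:R * u <= 4^-1 by rewrite mulrC -ler_pdivlMr// ltW.
  by have := Hn _ (opnorm_ge_dilation psi hr u0 nu4 n0); lra.
- have : ((2^-1 : R)%:E < limsup0 (fun u : R => psi (u ^+ (2 * n)) / psi u)%R)%E.
    by rewrite Hl ?muln_gt0// lte_fin; lra.
  have h2 : 0 < 2^-1 :> R by rewrite invr_gt0.
  move=> /limsup0_gt/(_ _ h2)[u /andP[u0 u2] Hu].
  have := Hn _ (opnorm_ge_power psi hr n u0 (ltW u2)).
  by rewrite ltr_pM2l// => H; have := lt_trans Hu H; rewrite ltxx.
Qed.

End dichotomy.

Theorem corollary13 (R : realType) (psi : Psi R) (r : R -> R)
    (hr : centered_bernoulli r) :
  let alt1 := exists q C : R, [/\ 2^-1 <= q, q < 1, 0 < C &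
    forall n : nat, (1 <= n)%N ->
      (opnorm psi r n <= (C * n%:R `^ q)%:E)%E] in
  let alt2 :=
    (forall k : nat, (1 <= k)%N ->
       limsup0 (fun u => psi (k%:R * u) / psi u) = k%:R%:E) \/
    (forall l : nat, (1 <= l)%N ->
       limsup0 (fun u => psi (u ^+ l) / psi u) = 1%:E) in
  (alt1 \/ alt2) /\ ~ (alt1 /\ alt2).
Proof.
move=> alt1 alt2; split; last first.
  by move=> [[q [C [_ q1 C0 Hop]]] H2]; exact: (opnorm_not_powR hr q1 C0 Hop).
have [|nalt2] := EM alt2; [by right|left].
have /not_orP[/existsNP[k /not_implyP[k1 kE]] /existsNP[l /not_implyP[l1 lE]]] := nalt2.
have [a [C1 [a2 a1 C11 growth]]] := limsup_dilation_lt k1 kE.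
have [g [D [delta [g0 D0 delta0 decay]]]] := limsup_power_lt l1 lE.
exact: (opnorm_le_powR hr a2 a1 g0 C11 D0 delta0 growth decay).
Qed.
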